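(* Let $a,c\in\mathbb{C}$ with $c\notin\{0,-1,-2,\dots\}$. The following operator identities hold when applied to functions of the form $f=g\circ y$ with $g\in C^\omega$: (i) with $y=\frac{x^2}{4(x-1)}$, $$(1-x)^{\frac a2}\,\mathcal{H}_c^a(x)\,(1-x)^{-\frac c2}=\mathcal{H}_{\frac{c+1}{2}}^{\frac a2}(y)\,(1-y)^{-\frac{c-a}{2}}\,\mathcal{H}_{\frac c2}^{\frac{a+1}{2}}(y);$$ (ii) with $y=\frac{x^2}{(2-x)^2}$, $$\left(1-\frac x2\right)^{a}\mathcal{H}_c^a(x)\left(1-\frac x2\right)^{-c}=\mathcal{H}_{\frac{c+1}{2}}^{\frac a2}(y)\,\mathcal{H}_{\frac c2}^{\frac{a+1}{2}}(y);$$ (iii) with $y=\frac{x^2}{x^2-1}$, $$(1-x^2)^{\frac{a+1}{2}}\,\mathcal{H}_c^a(x)\,(1-x^2)^{-\frac{c+1}{2}}=\mathcal{H}_{\frac c2}^{\frac{a+1}{2}}(y)\,(1-y)^{-\frac{c-a}{2}}\,\mathcal{H}_{\frac{c+1}{2}}^{\frac a2}(y).$$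
   Context: $C^\omega$ is the space of (germs of) functions analytic near $0\in\mathbb{C}$. $(q)_n=q(q+1)\cdots(q+n-1)$, $(q)_0=1$. For $a,c\in\mathbb{C}$ with $c\notin\{0,-1,-2,\dots\}$ the hypergeometrization is the linear operator $\mathcal{H}_c^a:C^\omega\to C^\omega$, $\mathcal{H}_c^a\left(\sum_n f_nx^n\right)=\sum_n f_n\frac{(a)_n}{(c)_n}x^n$; it is also denoted $\mathcal{H}_c^a(x)$. If $y=y(x)$ is analytic near $0$, non-constant, with $y(0)=0$, then $\mathcal{H}_c^a(y)$ acts on functions $g\circ y$, $g\in C^\omega$ (where $g$ is uniquely determined), by $\mathcal{H}_c^a(y)(g\circ y):=(\mathcal{H}_c^a g)\circ y$. A function $h\in C^\omega$ written in an operator expression denotes multiplication by $h$, and juxtaposition denotes composition. Complex powers of functions equal to $1$ at $0$ are the branches with value $1$ at $0$. *)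

(* Defs.v *)
From Stdlib Require Import Reals Lra ClassicalEpsilon.
From Coquelicot Require Export Coquelicot.
Open Scope R_scope.
Open Scope C_scope.

(** A germ at 0 is represented by any function [C -> C] that induces it; two
    functions represent the same germ when they agree [near0].  All the
    operators below depend only on the germ of their argument. *)

Definition near0 (P : C -> Prop) : Prop :=
  exists r : R, (0 < r)%R /\ forall x : C, (Cmod x < r)%R -> P x.

Definition germ_eq (f g : C -> C) : Prop := near0 (fun x => f x = g x).

Definition is_taylor (f : C -> C) (u : nat -> C) : Prop :=
  near0 (fun x => @is_pseries C_AbsRing C_NormedModule u x (f x)).

Definition analytic0 (f : C -> C) : Prop := exists u : nat -> C, is_taylor f u.

(** The Taylor coefficients are unique, so for an analytic [f] the choice below
    is the sequence of its coefficients. *)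
Definition taylor (f : C -> C) : nat -> C :=
  epsilon (inhabits (fun _ => RtoC 0)) (is_taylor f).

(** Sum of a convergent complex power series; unspecified if it diverges. *)
Definition CPSeries (u : nat -> C) (x : C) : C :=
  epsilon (inhabits (RtoC 0)) (@is_pseries C_AbsRing C_NormedModule u x).

Fixpoint poch (q : C) (n : nat) : C :=
  match n with
  | O => 1
  | S m => poch q m * (q + INR m)
  end.

Definition hyp (a c : C) (f : C -> C) : C -> C :=
  CPSeries (fun n => taylor f n * (poch a n / poch c n)).

Definition factors_by (y f g : C -> C) : Prop :=
  analytic0 g /\ germ_eq f (fun x => g (y x)).

(** For [y] analytic, non-constant, with [y 0 = 0], the germ [g] with
    [f = g o y] is unique if it exists; [outer y f] is a representative. *)
Definition outer (y f : C -> C) : C -> C :=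
  epsilon (inhabits (fun _ => RtoC 0)) (factors_by y f).

Definition hyp_at (a c : C) (y : C -> C) (f : C -> C) : C -> C :=
  fun x => hyp a c (outer y f) (y x).

Definition mult (h f : C -> C) : C -> C := fun x => h x * f x.

Definition Cexp (z : C) : C :=
  (exp (Re z) * cos (Im z), exp (Re z) * sin (Im z))%R.

(** Principal logarithm, on the half-plane [0 < Re z] only (elsewhere the
    argument is not [atan (Im z / Re z)]); it is only used near 1. *)
Definition Clog (z : C) : C := (ln (Cmod z), atan (Im z / Re z))%R.

(** For a function [u] with [u 0 = 1], [fun x => Cpower (u x) s] is near 0 the
    branch of [u ^ s] with value 1 at 0. *)
Definition Cpower (z s : C) : C := Cexp (s * Clog z).

Lemma Cexp_Clog (z : C) : (0 < Re z)%R -> Cexp (Clog z) = z.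
Proof.
destruct z as [p q]; unfold Cexp, Clog, Re, Im; simpl; intros Hp.
assert (Hs : (0 < p ^ 2 + q ^ 2)%R) by nra.
assert (Hm : (0 < Cmod (p, q))%R) by (now apply sqrt_lt_R0).
rewrite exp_ln by exact Hm.
rewrite cos_atan, sin_atan.
assert (E : sqrt (1 + Rsqr (q / p)) = (Cmod (p, q) / p)%R).
{ unfold Cmod; simpl fst; simpl snd.
  replace (1 + Rsqr (q / p))%R with ((p ^ 2 + q ^ 2) / Rsqr p)%R
    by (unfold Rsqr; field; lra).
  rewrite sqrt_div_alt by (unfold Rsqr; nra).
  now rewrite sqrt_Rsqr by lra. }
rewrite E.
f_equal; field; lra.
Qed.

Lemma Cpower_1 (s : C) : Cpower 1 s = 1.
Proof.
unfold Cpower, Clog; rewrite Cmod_1, ln_1; simpl.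
replace (0 / 1)%R with 0%R by field.
rewrite atan_0.
replace (s * (0%R, 0%R)) with (RtoC 0) by (destruct s; unfold Cmult, RtoC; simpl; f_equal; ring).
unfold Cexp, Re, Im, RtoC; simpl.
now rewrite exp_0, cos_0, sin_0, Rmult_1_l, Rmult_0_r.
Qed.

(* Main.v *)
Require Import Defs.
From Stdlib Require Import Reals Lra Lia Arith FunctionalExtensionality ClassicalEpsilon.
Open Scope R_scope.
Open Scope C_scope.

(** All three identities reduce to one cancellation.  By the binomial series, the
    coefficient of [x ^ N] in
    [(1 - lam x) ^ - c * k (kap * (x / (1 - lam x)) ^ m)] is a sum over [n] of
    [k_n kap ^ n lam ^ (N - m n) (c + m n)_(N - m n) / (N - m n)!].  The operator
    [H_c^a] multiplies it by [(a)_N / (c)_N], and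
    [(c)_N = (c)_(m n) (c + m n)_(N - m n)], so the result has the same shape with
    weight [(1 - lam x) ^ - a] and with [k_n] multiplied by
    [(a)_(m n) / (c)_(m n)].  This is [hyp_weighted].

    For [m = 1], [lam = 1], [kap = -1] it says that [H_c^a] commutes with the
    substitution [sigma z = z / (z - 1)], up to the change of weight from
    [(1 - z) ^ - c] to [(1 - z) ^ - a].  For [m = 2] the duplication
    [(a)_(2 n) = 4 ^ n (a/2)_n ((a+1)/2)_n] turns [H_c^a] into the product of the two
    operators with halved parameters, acting in the variable
    [z = kap * (x / (1 - lam x)) ^ 2].

    The case [m = 2], [lam = 1/2], [kap = 1/4] is the identity for
    [y = x ^ 2 / (2 - x) ^ 2].  In the other two the variable is [y = sigma z], where
    [z] is [x ^ 2 / (2 - x) ^ 2] for [y = x ^ 2 / (4 (x - 1))], and [z = x ^ 2] (that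
    is, [lam = 0]) for [y = x ^ 2 / (x ^ 2 - 1)].  There the [m = 1] case is applied to each of the
    two operators in turn.  The weight left by the first one has exponent [- A']
    while the second one needs [- C]; since [1 - sigma z = / (1 - z)], the
    discrepancy [(1 - z) ^ (C - A')] is the factor [(1 - y) ^ - (C - A')] that
    stands between the two operators, and [C - A' = (c - a) / 2] in both cases.
    This is [hyp_hyp_pfaff] and, combined with [m = 2], [quadratic_pfaff].

    The analytic input consists of the uniqueness of Taylor coefficients and of the
    outer function [g] ([taylor_unique_accum]), the rearrangement of a triangular
    double series ([Cpseries_triangular]) and the binomial series for the given
    branch of the complex power ([binomial_series]). *)

(** * Power series with complex coefficients *)

Notation Cpseries := (@is_pseries C_AbsRing C_NormedModule).
Definition Csum (a : nat -> Complex.C) (n : nat) : Complex.C := @sum_n C_AbelianMonoid a n.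

Notation pterm a x := (fun k : nat => Cmult (a k) (Cpow x k)).

Definition geom_bound (K T : R) (u : nat -> Complex.C) : Prop :=
  forall n, (Cmod (u n) <= K * T ^ n)%R.

Lemma Csum_S (a : nat -> Complex.C) (n : nat) : Csum a (S n) = Csum a n + a (S n).
Proof. apply (@sum_Sn C_AbelianMonoid). Qed.

Lemma Csum_0 (a : nat -> Complex.C) : Csum a 0%nat = a 0%nat.
Proof. apply (@sum_O C_AbelianMonoid). Qed.

Lemma Csum_pterm (a : nat -> Complex.C) (x : Complex.C) (n : nat) :
  Csum (pterm a x) n
  = Csum (fun k => @scal C_AbsRing C_NormedModule (@pow_n C_AbsRing x k) (a k)) n.
Proof. apply (@sum_n_ext C_AbelianMonoid); intros k; apply Cmult_comm. Qed.

Lemma Cpseries_eps (a : nat -> Complex.C) (x l : Complex.C) :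
  Cpseries a x l <->
  forall eps : R, (0 < eps)%R -> exists N, forall n, (N <= n)%nat ->
    (Cmod (Csum (pterm a x) n - l)%C < eps)%R.
Proof.
unfold is_pseries, is_series; split.
- intros H eps Heps.
  destruct (proj1 (filterlim_locally_ball_norm (K := C_AbsRing) (U := C_NormedModule)
    (F := Hierarchy.eventually) _ _) H (mkposreal eps Heps)) as [N HN]; exists N; intros n Hn.
  rewrite Csum_pterm; exact (HN n Hn).
- intros H; apply (filterlim_locally_ball_norm (K := C_AbsRing) (U := C_NormedModule)
    (F := Hierarchy.eventually)).
  intros [eps Heps]; destruct (H eps Heps) as [N HN]; exists N; intros n Hn.
  unfold ball_norm; rewrite <- Csum_pterm; exact (HN n Hn).
Qed.

Lemma Cpseries_unique (a : nat -> Complex.C) (x l l' : Complex.C) :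
  Cpseries a x l -> Cpseries a x l' -> l = l'.
Proof. apply (@filterlim_locally_unique nat C_AbsRing C_NormedModule Hierarchy.eventually _). Qed.

Lemma Cpseries_ext (a b : nat -> Complex.C) (x l : Complex.C) :
  (forall n, a n = b n) -> Cpseries a x l -> Cpseries b x l.
Proof. intros H; apply is_pseries_ext; exact H. Qed.

(** The geometric tail, doubled because the ratio is at most [1/2]. *)
Lemma Cpseries_tail (a : nat -> Complex.C) (x l : Complex.C) (K T : R) (L : nat) :
  (0 <= K)%R -> (0 <= T)%R -> geom_bound K T a -> (T * Cmod x <= / 2)%R ->
  Cpseries a x l ->
  (Cmod (l - Csum (pterm a x) L)%C <= 2 * K * (T * Cmod x) ^ S L)%R.
Proof.
intros HK HT Ha Hx Hl; set (q := (T * Cmod x)%R) in *.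
assert (Hq : (0 <= q)%R) by (apply Rmult_le_pos; [assumption|apply Cmod_ge_0]).
assert (P : forall n, (0 <= q ^ n)%R) by (intros; apply pow_le; assumption).
assert (B : forall d, (Cmod (Csum (pterm a x) (d + L) - Csum (pterm a x) L)%C
   <= 2 * K * (q ^ S L - q ^ S (d + L)))%R).
{ induction d as [|d IH].
  - change (0 + L)%nat with L.
    replace (Csum _ L - Csum _ L)%C with (RtoC 0) by ring. rewrite Cmod_0; lra.
  - change (S d + L)%nat with (S (d + L)); rewrite Csum_S.
    match goal with |- (Cmod (?s + ?t - ?r)%C <= _)%R => replace (s + t - r)%C with ((s - r) + t)%C by ring end.
    eapply Rle_trans; [apply Cmod_triangle|].
    assert (Cmod (a (S (d + L)) * x ^ S (d + L))%C <= K * q ^ S (d + L))%R.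
    { rewrite Cmod_mult, Cmod_pow; unfold q; rewrite Rpow_mult_distr, <- Rmult_assoc.
      apply Rmult_le_compat_r; [apply pow_le, Cmod_ge_0 | apply Ha]. }
    assert (K * q ^ S (S (d + L)) <= K * q ^ S (d + L) * / 2)%R.
    { change (q ^ S (S (d + L)))%R with (q * q ^ S (d + L))%R.
      assert (0 <= K * q ^ S (d + L))%R by (apply Rmult_le_pos; auto). nra. }
    lra. }
apply le_epsilon; intros eps Heps.
destruct (proj1 (Cpseries_eps a x l) Hl eps Heps) as [N HN].
specialize (HN (N + L)%nat (Nat.le_add_r _ _)); specialize (B N).
match goal with |- (Cmod (?l - ?s)%C <= _)%R =>
  replace (l - s)%C with ((Csum (pterm a x) (N + L) - s) + - (Csum (pterm a x) (N + L) - l))%C by ring end.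
eapply Rle_trans; [apply Cmod_triangle|]; rewrite Cmod_opp.
assert (0 <= K * q ^ S (N + L))%R by (apply Rmult_le_pos; auto). lra.
Qed.

Lemma Cpseries_geom_bound (a : nat -> Complex.C) (x l : Complex.C) :
  x <> 0 -> Cpseries a x l ->
  exists K T, (0 < K)%R /\ (1 <= T)%R /\ geom_bound K T a.
Proof.
intros Hx H.
destruct (@filterlim_bounded C_AbsRing C_NormedModule _ (ex_intro _ l H)) as [M HM].
assert (Hr : (0 < Cmod x)%R) by (now apply Cmod_gt_0).
assert (HM0 : (0 <= M)%R) by (eapply Rle_trans; [apply (@norm_ge_0 C_AbsRing C_NormedModule) | apply (HM 0%nat)]).
assert (HS : forall n, (Cmod (Csum (pterm a x) n) <= M)%R).
{ intros n; rewrite (Csum_pterm a x n); apply HM. }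
assert (HT : (forall n, Cmod (a n) * Cmod x ^ n <= 2 * M + 1)%R).
{ intros n; rewrite <- Cmod_pow, <- Cmod_mult; destruct n as [|n].
  - specialize (HS 0%nat); rewrite Csum_0 in HS; lra.
  - pose proof (HS n) as H1; pose proof (HS (S n)) as H2; rewrite Csum_S in H2.
    match type of H2 with (Cmod (?s + ?t)%C <= _)%R =>
      replace t with ((s + t) + - s)%C by ring end.
    eapply Rle_trans; [apply Cmod_triangle|]; rewrite Cmod_opp; lra. }
exists (2 * M + 1)%R, (Rmax 1 (/ Cmod x)); repeat split; [lra|apply Rmax_l|].
intros n; apply Rle_trans with ((2 * M + 1) * (/ Cmod x) ^ n)%R.
- rewrite pow_inv; apply Rmult_le_reg_r with (Cmod x ^ n)%R; [now apply pow_lt|].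
  rewrite Rmult_assoc, Rinv_l, Rmult_1_r by (apply pow_nonzero; lra); apply HT.
- apply Rmult_le_compat_l; [lra|]; apply pow_incr; split; [|apply Rmax_r].
  apply Rlt_le, Rinv_0_lt_compat, Hr.
Qed.

Lemma Cpseries_converges (a : nat -> Complex.C) (x : Complex.C) (K T : R) :
  geom_bound K T a -> (0 <= T)%R -> (T * Cmod x < 1)%R -> exists l, Cpseries a x l.
Proof.
intros Ha HT Hx.
apply (@ex_series_le C_AbsRing C_CompleteNormedModule _ (fun n => K * (T * Cmod x) ^ n)%R).
- intros n.
  change (Cmod (x ^ n * a n)%C <= K * (T * Cmod x) ^ n)%R.
  rewrite Cmult_comm, Cmod_mult, Cmod_pow, Rpow_mult_distr, <- Rmult_assoc.
  apply Rmult_le_compat_r; [apply pow_le, Cmod_ge_0 | apply Ha].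
- apply (@ex_series_scal R_AbsRing R_NormedModule K), ex_series_geom.
  rewrite Rabs_pos_eq; [assumption|]. apply Rmult_le_pos; [assumption|apply Cmod_ge_0].
Qed.

(** * Germs *)

Lemma near0_and (P Q : Complex.C -> Prop) :
  near0 P -> near0 Q -> near0 (fun x => P x /\ Q x).
Proof.
intros (r & Hr & H) (s & Hs & H'); exists (Rmin r s); split.
- now apply Rmin_pos.
- intros x Hx; split; [apply H | apply H']; eapply Rlt_le_trans; eauto; [apply Rmin_l | apply Rmin_r].
Qed.

Lemma near0_imp (P Q : Complex.C -> Prop) :
  (forall x, P x -> Q x) -> near0 P -> near0 Q.
Proof. intros H (r & Hr & HP); exists r; auto. Qed.

Lemma near0_all (P : Complex.C -> Prop) : (forall x, P x) -> near0 P.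
Proof. exists 1%R; split; [lra|auto]. Qed.

Lemma near0_exists (P : Complex.C -> Prop) (eps : R) :
  (0 < eps)%R -> near0 P -> exists x : Complex.C, x <> 0 /\ (Cmod x < eps)%R /\ P x.
Proof.
intros He (r & Hr & HP).
assert (Hm : (0 < Rmin eps r)%R) by (now apply Rmin_pos).
exists (RtoC (Rmin eps r / 2)%R).
assert (E : Cmod (RtoC (Rmin eps r / 2)%R) = (Rmin eps r / 2)%R)
  by (rewrite Cmod_R, Rabs_pos_eq; lra).
pose proof (Rmin_l eps r); pose proof (Rmin_r eps r).
repeat split.
- apply Cmod_gt_0; rewrite E; lra.
- rewrite E; lra.
- apply HP; rewrite E; lra.
Qed.

Lemma is_taylor_germ (f g : Complex.C -> Complex.C) (u : nat -> Complex.C) :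
  germ_eq f g -> is_taylor f u -> is_taylor g u.
Proof.
intros H1 H2; generalize (near0_and _ _ H1 H2); apply near0_imp.
intros x [E H]; now rewrite <- E.
Qed.

Lemma germ_trans (f g h : Complex.C -> Complex.C) :
  germ_eq f g -> germ_eq g h -> germ_eq f h.
Proof.
intros H1 H2; generalize (near0_and _ _ H1 H2); apply near0_imp; intros x [-> ->]; reflexivity.
Qed.

Lemma is_taylor_eq (f g : Complex.C -> Complex.C) (u : nat -> Complex.C) :
  is_taylor f u -> is_taylor g u -> germ_eq f g.
Proof.
intros H1 H2; generalize (near0_and _ _ H1 H2); apply near0_imp.
intros x [H H']; eapply Cpseries_unique; eauto.
Qed.

Lemma is_taylor_geom (f : Complex.C -> Complex.C) (u : nat -> Complex.C) :
  is_taylor f u -> exists K T, (0 < K)%R /\ (1 <= T)%R /\ geom_bound K T u.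
Proof.
intros H; destruct (near0_exists _ 1 Rlt_0_1 H) as (x & Hx & _ & Hs).
eapply Cpseries_geom_bound; eauto.
Qed.

Lemma CPSeries_taylor (u : nat -> Complex.C) (K T : R) :
  (0 < T)%R -> geom_bound K T u -> is_taylor (CPSeries u) u.
Proof.
intros HT Hu; exists (/ T)%R; split; [now apply Rinv_0_lt_compat|].
intros x Hx; unfold CPSeries; apply epsilon_spec.
apply Cpseries_converges with K T; auto; [lra|].
apply Rmult_lt_reg_l with (/ T)%R; [now apply Rinv_0_lt_compat|].
rewrite <- Rmult_assoc, Rinv_l, Rmult_1_l, Rmult_1_r by lra; exact Hx.
Qed.

Lemma Csum_zero (a : nat -> Complex.C) (n : nat) :
  (forall k, (k <= n)%nat -> a k = RtoC 0) -> Csum a n = RtoC 0.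
Proof.
induction n as [|n IH]; intros H.
- rewrite Csum_0; auto.
- rewrite Csum_S, IH, H by auto; ring.
Qed.

(** Isolated zeros: the lowest nonvanishing term of the difference would
    dominate the rest of the series near the origin. *)
Lemma taylor_unique_accum (f g : Complex.C -> Complex.C) (u v : nat -> Complex.C) :
  is_taylor f u -> is_taylor g v ->
  (forall eps, (0 < eps)%R -> exists x : Complex.C, x <> 0 /\ (Cmod x < eps)%R /\ f x = g x) ->
  u = v.
Proof.
intros Hf Hg Hz.
set (w n := u n - v n).
assert (Hw : is_taylor (fun x => f x - g x) w).
{ generalize (near0_and _ _ Hf Hg); apply near0_imp; intros x [H1 H2].
  apply (@is_pseries_plus C_AbsRing C_NormedModule u (fun n => - v n) x (f x) (- g x)); auto.
  apply (@is_pseries_opp C_AbsRing C_NormedModule); auto. }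
destruct (is_taylor_geom _ _ Hw) as (K & T & HK & HT & HB).
destruct Hw as (r & Hr & Hw).
assert (Z : forall n, w n = 0).
{ intros n; induction n as [n IH] using lt_wf_ind.
  apply Cmod_eq_0; apply Rle_antisym; [|apply Cmod_ge_0].
  apply le_epsilon; intros eps Heps; rewrite Rplus_0_l.
  (* The tail after [w n * x ^ n] is at most [D * |x| ^ (n + 1)], so
     [|w n| <= D * |x|] at every zero [x] that is small enough. *)
  set (D := (2 * K * T ^ S n)%R).
  assert (HD : (0 < D)%R) by (unfold D; assert (0 < T ^ S n)%R by (apply pow_lt; lra); nra).
  set (e := Rmin r (Rmin (/ 2 / T) (eps / D))).
  assert (He : (0 < e)%R).
  { repeat apply Rmin_pos; auto; apply Rdiv_lt_0_compat; lra. }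
  destruct (Hz e He) as (x & Hx & Hxe & Hfg).
  assert (Hx1 : (Cmod x < r)%R) by (eapply Rlt_le_trans; [exact Hxe | apply Rmin_l]).
  assert (Hx2 : (T * Cmod x <= / 2)%R).
  { apply Rle_trans with (T * (/ 2 / T))%R; [|right; field; lra].
    apply Rmult_le_compat_l; [lra|]; apply Rlt_le; eapply Rlt_le_trans; [exact Hxe|].
    eapply Rle_trans; [apply Rmin_r | apply Rmin_l]. }
  assert (Hx3 : (D * Cmod x <= eps)%R).
  { apply Rle_trans with (D * (eps / D))%R; [|right; field; lra].
    apply Rmult_le_compat_l; [lra|]; apply Rlt_le; eapply Rlt_le_trans; [exact Hxe|].
    eapply Rle_trans; [apply Rmin_r | apply Rmin_r]. }
  specialize (Hw x Hx1).
  pose proof (Cpseries_tail w x _ K T n (Rlt_le _ _ HK) ltac:(lra) HB Hx2 Hw) as Ht.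
  assert (Es : Csum (pterm w x) n = w n * x ^ n).
  { destruct n as [|n]; [now rewrite Csum_0|].
    rewrite Csum_S, Csum_zero; [ring|].
    intros k Hk; rewrite IH by lia; ring. }
  rewrite Es, Hfg in Ht.
  replace (g x - g x - w n * x ^ n) with (- (w n * x ^ n)) in Ht by ring.
  rewrite Cmod_opp, Cmod_mult, Cmod_pow, Rpow_mult_distr in Ht.
  assert (Hp : (0 < Cmod x)%R) by (now apply Cmod_gt_0).
  apply Rmult_le_reg_r with (Cmod x ^ n)%R; [now apply pow_lt|].
  apply Rle_trans with (1 := Ht).
  apply Rle_trans with (D * Cmod x * Cmod x ^ n)%R; [right; unfold D; simpl; ring|].
  apply Rmult_le_compat_r; [apply pow_le; lra | exact Hx3]. }
apply functional_extensionality; intros n.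
specialize (Z n); unfold w in Z.
replace (u n) with (u n - v n + v n) by ring; rewrite Z; ring.
Qed.

Lemma is_taylor_unique (f : Complex.C -> Complex.C) (u v : nat -> Complex.C) :
  is_taylor f u -> is_taylor f v -> u = v.
Proof.
intros Hu Hv; apply (taylor_unique_accum f f); auto.
intros eps He; exists (RtoC (eps / 2)%R); repeat split.
- apply Cmod_gt_0; rewrite Cmod_R, Rabs_pos_eq; lra.
- rewrite Cmod_R, Rabs_pos_eq; lra.
Qed.

Lemma taylor_eq (f : Complex.C -> Complex.C) (u : nat -> Complex.C) :
  is_taylor f u -> taylor f = u.
Proof.
intros H; apply is_taylor_unique with f; [|assumption].
unfold taylor; apply epsilon_spec; now exists u.
Qed.

(** * Finite sums and triangular double series *)

Lemma Csum_ext (a b : nat -> Complex.C) (n : nat) :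
  (forall k, (k <= n)%nat -> a k = b k) -> Csum a n = Csum b n.
Proof. apply (@sum_n_ext_loc C_AbelianMonoid). Qed.

Lemma Cpseries_same_terms (a b : nat -> Complex.C) (x x' l : Complex.C) :
  (forall k, a k * x ^ k = b k * x' ^ k) -> Cpseries a x l -> Cpseries b x' l.
Proof.
intros E H; apply (proj2 (Cpseries_eps _ _ _)); intros eps Heps.
destruct (proj1 (Cpseries_eps _ _ _) H eps Heps) as [N HN].
exists N; intros n Hn; specialize (HN n Hn).
replace (Csum (pterm b x') n) with (Csum (pterm a x) n); [exact HN|].
apply Csum_ext; auto.
Qed.

Lemma Csum_mult_r (a : nat -> Complex.C) (z : Complex.C) (n : nat) :
  Csum (fun k => a k * z) n = Csum a n * z.
Proof. apply (@sum_n_mult_r C_Ring z a n). Qed.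

Lemma Csum_minus (a b : nat -> Complex.C) (n : nat) :
  Csum (fun k => a k - b k) n = Csum a n - Csum b n.
Proof.
induction n as [|n IH]; [now rewrite !Csum_0|].
rewrite !Csum_S, IH; ring.
Qed.

Lemma Csum_switch (a : nat -> nat -> Complex.C) (m n : nat) :
  Csum (fun i => Csum (a i) n) m = Csum (fun j => Csum (fun i => a i j) m) n.
Proof. apply (@sum_n_switch C_AbelianMonoid). Qed.

Lemma Csum_truncate (a : nat -> Complex.C) (n d : nat) :
  (forall k, (n < k)%nat -> a k = RtoC 0) -> Csum a (d + n) = Csum a n.
Proof.
intros H; induction d as [|d IH]; [reflexivity|].
change (S d + n)%nat with (S (d + n)); rewrite Csum_S, IH, H by lia; ring.
Qed.

Lemma Csum_bound (a : nat -> Complex.C) (B : R) (n : nat) :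
  (forall k, (Cmod (a k) <= B)%R) -> (Cmod (Csum a n) <= INR (S n) * B)%R.
Proof.
intros H; induction n as [|n IH].
- rewrite Csum_0; simpl; specialize (H 0%nat); lra.
- rewrite Csum_S, S_INR; eapply Rle_trans; [apply Cmod_triangle|].
  specialize (H (S n)); lra.
Qed.

Lemma INR_le_pow2 (n : nat) : (INR n <= 2 ^ n)%R.
Proof.
induction n as [|n IH]; [simpl; lra|].
rewrite S_INR; simpl pow.
assert (1 <= 2 ^ n)%R by (apply pow_R1_Rle; lra). lra.
Qed.

(** Column sums of a lower triangular array.  Replacing both summations by the
    square of side [L] costs [L + 1] geometric tails, hence at most
    [(L + 1) * 4 ^ - (L + 1)] up to a constant. *)
Lemma Cpseries_triangular (A : nat -> nat -> Complex.C) (rs : nat -> Complex.C)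
    (x s : Complex.C) (K T : R) :
  (0 <= K)%R -> (0 <= T)%R ->
  (forall n N, (N < n)%nat -> A n N = RtoC 0) ->
  (forall n, geom_bound K T (A n)) ->
  (T * Cmod x <= / 4)%R ->
  (forall n, Cpseries (A n) x (rs n)) ->
  Cpseries rs (RtoC 1) s ->
  Cpseries (fun N => Csum (fun n => A n N) N) x s.
Proof.
intros HK HT Hz Hb Hx HR Hs.
apply (proj2 (Cpseries_eps _ _ _)); intros eps Heps.
destruct (proj1 (Cpseries_eps _ _ _) Hs (eps / 2)%R ltac:(lra)) as [N1 H1].
assert (H2 : exists N2, forall n, (N2 <= n)%nat -> (2 * K * (/ 2) ^ n < eps / 2)%R).
{ destruct (pow_lt_1_zero (/ 2) ltac:(rewrite Rabs_pos_eq; lra) (eps / (4 * K + 1)))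
    as [N2 H2]; [apply Rdiv_lt_0_compat; lra|].
  exists N2; intros n Hn; specialize (H2 n Hn).
  rewrite Rabs_pos_eq in H2 by (apply pow_le; lra).
  apply Rle_lt_trans with ((4 * K + 1) / 2 * (/ 2) ^ n)%R.
  - apply Rmult_le_compat_r; [apply pow_le|]; lra.
  - apply Rlt_le_trans with ((4 * K + 1) / 2 * (eps / (4 * K + 1)))%R;
      [apply Rmult_lt_compat_l; lra | right; field; lra]. }
destruct H2 as [N2 H2].
exists (N1 + N2)%nat; intros L HL.
assert (E : Csum (pterm (fun N => Csum (fun n => A n N) N) x) L
  = Csum (fun n => Csum (pterm (A n) x) L) L).
{ rewrite (Csum_switch (fun n N => A n N * x ^ N)).
  apply Csum_ext; intros N HN; rewrite Csum_mult_r; f_equal.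
  replace L with ((L - N) + N)%nat by lia.
  symmetry; apply Csum_truncate; intros; apply Hz; assumption. }
rewrite E.
specialize (H1 L ltac:(lia)); specialize (H2 (S L) ltac:(lia)).
replace (Csum (pterm rs 1) L) with (Csum rs L) in H1
  by (apply Csum_ext; intros; rewrite Cpow_1_l; ring).
assert (B : (Cmod (Csum rs L - Csum (fun n => Csum (pterm (A n) x) L) L)%C
   <= 2 * K * (/ 2) ^ S L)%R).
{ rewrite <- Csum_minus.
  eapply Rle_trans; [apply Csum_bound with (B := (2 * K * (/ 4) ^ S L)%R)|].
  - intros n; eapply Rle_trans; [apply (Cpseries_tail _ _ _ K T); auto; lra|].
    apply Rmult_le_compat_l; [lra|]; apply pow_incr; split; [|assumption].
    apply Rmult_le_pos; [assumption | apply Cmod_ge_0].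
  - replace (/ 4)%R with (/ 2 * / 2)%R by field; rewrite Rpow_mult_distr.
    pose proof (INR_le_pow2 (S L)) as Hp.
    assert (0 < (/ 2) ^ S L)%R by (apply pow_lt; lra).
    assert (2 ^ S L * (/ 2) ^ S L = 1)%R
      by (rewrite <- Rpow_mult_distr; replace (2 * / 2)%R with 1%R by field; apply pow1).
    assert (INR (S L) * (/ 2) ^ S L <= 1)%R by nra.
    assert (0 <= 2 * K * (/ 2) ^ S L)%R by (apply Rmult_le_pos; lra).
    nra. }
replace (Csum (fun n => Csum (pterm (A n) x) L) L - s)
  with ((Csum rs L - s) + - (Csum rs L - Csum (fun n => Csum (pterm (A n) x) L) L)) by ring.
eapply Rle_lt_trans; [apply Cmod_triangle|]; rewrite Cmod_opp; lra.
Qed.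

Lemma Cpseries_shift (a : nat -> Complex.C) (d : nat) (x l : Complex.C) :
  Cpseries a x l ->
  Cpseries (fun N => if le_lt_dec d N then a (N - d)%nat else RtoC 0) x (x ^ d * l).
Proof.
intros H; apply Cpseries_ext with (@PS_incr_n C_AbsRing C_NormedModule a d).
- intros N; apply (@PS_incr_n_simplify C_AbsRing C_NormedModule).
- apply (@is_pseries_incr_n C_AbsRing C_NormedModule a d x l H).
Qed.

(** * Pochhammer symbols and binomial coefficients *)

Lemma INR_C_add (m n : nat) : RtoC (INR (m + n)) = INR m + INR n.
Proof. now rewrite plus_INR, RtoC_plus. Qed.

Lemma INR_C_S (n : nat) : RtoC (INR (S n)) = INR n + 1.
Proof. now rewrite S_INR, RtoC_plus. Qed.

Lemma INR_S_neq0 (n : nat) : RtoC (INR (S n)) <> 0.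
Proof. intros H; apply RtoC_inj in H; revert H; apply not_0_INR; discriminate. Qed.

Lemma poch_add (q : Complex.C) (m n : nat) : poch q (m + n) = poch q m * poch (q + INR m) n.
Proof.
induction n as [|n IH].
- rewrite Nat.add_0_r; simpl; ring.
- rewrite Nat.add_succ_r; simpl; rewrite IH, INR_C_add; ring.
Qed.

Lemma poch_double (q : Complex.C) (n : nat) :
  poch q (2 * n) = 4 ^ n * (poch (q / 2) n * poch ((q + 1) / 2) n).
Proof.
induction n as [|n IH]; [simpl; ring|].
replace (2 * S n)%nat with (S (S (2 * n))) by lia.
cbn [poch]; rewrite IH, Cpow_S, INR_C_S, mult_INR, RtoC_mult.
change (INR 2) with 2%R; field.
Qed.

Lemma poch_neq0 (c : Complex.C) :
  (forall n : nat, c <> - INR n) -> forall n, poch c n <> 0.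
Proof.
intros hc n; induction n as [|n IH]; simpl.
- exact C1_nz.
- apply Cmult_neq_0; [assumption|]; intros H; apply (hc n).
  replace c with (c + INR n - INR n) by ring; rewrite H; ring.
Qed.

Lemma half_not_neg_nat (c : Complex.C) :
  (forall n : nat, c <> - INR n) ->
  (forall n : nat, c / 2 <> - INR n) /\ (forall n : nat, (c + 1) / 2 <> - INR n).
Proof.
intros hc; split; intros n H.
- apply (hc (n + n)%nat); rewrite INR_C_add.
  replace c with (c / 2 + c / 2) by field; rewrite H; ring.
- apply (hc (S (n + n))); rewrite INR_C_S, INR_C_add.
  replace c with ((c + 1) / 2 + (c + 1) / 2 - 1) by field; rewrite H; ring.
Qed.

(** [|a + n| / |c + n|] tends to 1, so it is bounded. *)
Lemma shift_ratio_bound (a c : Complex.C) :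
  (forall n : nat, c <> - INR n) ->
  exists D, (1 <= D)%R /\ forall n : nat, (Cmod (a + INR n)%C <= D * Cmod (c + INR n)%C)%R.
Proof.
intros hc.
assert (P : forall n, (0 < Cmod (c + INR n)%C)%R).
{ intros n; apply Cmod_gt_0; intros H; apply (hc n).
  replace c with (c + INR n - INR n) by ring; rewrite H; ring. }
assert (F : forall N, exists D, (1 <= D)%R /\ forall n : nat, (n < N)%nat ->
    (Cmod (a + INR n)%C <= D * Cmod (c + INR n)%C)%R).
{ induction N as [|N (D & HD & H)]; [exists 1%R; split; [lra|intros; lia]|].
  exists (Rmax D (Cmod (a + INR N)%C / Cmod (c + INR N)%C)); split.
  - eapply Rle_trans; [exact HD | apply Rmax_l].
  - intros n Hn; specialize (P n); destruct (Nat.eq_dec n N) as [->|Hne].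
    + apply Rle_trans with (Cmod (a + INR N)%C / Cmod (c + INR N)%C * Cmod (c + INR N)%C)%R.
      * right; field; lra.
      * apply Rmult_le_compat_r; [lra | apply Rmax_r].
    + eapply Rle_trans; [apply H; lia|].
      apply Rmult_le_compat_r; [lra | apply Rmax_l]. }
(* From this index on, [|c + n| >= n / 2] and [|a + n| <= 2 * n]. *)
destruct (INR_unbounded (2 * Cmod c + Cmod a)) as [N HN].
destruct (F N) as (D & HD & HF).
exists (Rmax D 4); split; [eapply Rle_trans; [exact HD | apply Rmax_l]|].
intros n; destruct (Nat.lt_ge_cases n N) as [Hn|Hn].
- eapply Rle_trans; [now apply HF|].
  apply Rmult_le_compat_r; [apply Cmod_ge_0 | apply Rmax_l].
- apply Rle_trans with (4 * Cmod (c + INR n)%C)%R.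
  + assert (HN' : (2 * Cmod c + Cmod a < INR n)%R)
      by (eapply Rlt_le_trans; [exact HN | now apply le_INR]).
    pose proof (Cmod_ge_0 a); pose proof (Cmod_ge_0 c).
    pose proof (Cmod_triangle a (INR n)) as H1.
    pose proof (Cmod_triangle (c + INR n) (- c)) as H2.
    replace (c + INR n + - c) with (RtoC (INR n)) in H2 by ring.
    rewrite Cmod_opp in H2; rewrite Cmod_R, Rabs_pos_eq in H1, H2 by apply pos_INR.
    lra.
  + apply Rmult_le_compat_r; [apply Cmod_ge_0 | apply Rmax_r].
Qed.

Lemma poch_ratio_bound (a c : Complex.C) :
  (forall n : nat, c <> - INR n) ->
  exists D, (1 <= D)%R /\ geom_bound 1 D (fun n => poch a n / poch c n).
Proof.
intros hc; destruct (shift_ratio_bound a c hc) as (D & HD & H).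
exists D; split; [assumption|]; intros n; rewrite Rmult_1_l.
rewrite Cmod_div by now apply poch_neq0.
assert (P : forall k, (0 < Cmod (poch c k))%R) by (intros; now apply Cmod_gt_0, poch_neq0).
apply Rmult_le_reg_r with (Cmod (poch c n)); [auto|].
unfold Rdiv; rewrite Rmult_assoc, Rinv_l, Rmult_1_r by (apply Rgt_not_eq, P).
induction n as [|n IH]; [simpl; lra|].
cbn [poch]; rewrite !Cmod_mult; simpl pow.
apply Rle_trans with ((D ^ n * Cmod (poch c n)) * (D * Cmod (c + INR n)%C))%R; [|right; ring].
apply Rmult_le_compat; auto using Cmod_ge_0.
Qed.

(** The coefficient of [x ^ j] in [(1 - x) ^ - p]. *)
Definition binc (p : Complex.C) (j : nat) : Complex.C := poch p j / INR (fact j).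

Lemma INR_fact_neq0 (j : nat) : RtoC (INR (fact j)) <> 0.
Proof. intros H; apply RtoC_inj in H; revert H; apply INR_fact_neq_0. Qed.

Lemma binc_0 (p : Complex.C) : binc p 0 = 1.
Proof. unfold binc; simpl; field. Qed.

Lemma binc_S (p : Complex.C) (j : nat) :
  INR (S j) * binc p (S j) = (p + INR j) * binc p j.
Proof.
unfold binc; rewrite fact_simpl, mult_INR, RtoC_mult; cbn [poch].
field; split; [apply INR_fact_neq0 | apply INR_S_neq0].
Qed.

Lemma binc_pascal (p : Complex.C) (j : nat) :
  binc (p + 1) (S j) = binc (p + 1) j + binc p (S j).
Proof.
assert (E : binc p (S j) = p / INR (S j) * binc (p + 1) j).
{ unfold binc; rewrite fact_simpl, mult_INR, RtoC_mult.
  change (S j) with (1 + j)%nat at 1; rewrite poch_add; simpl poch; simpl INR.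
  replace (p + 0) with p by ring.
  field; split; [apply INR_fact_neq0 | apply INR_S_neq0]. }
rewrite E.
replace (binc (p + 1) (S j)) with ((p + 1 + INR j) / INR (S j) * binc (p + 1) j).
- rewrite INR_C_S; field; rewrite <- INR_C_S; apply INR_S_neq0.
- transitivity ((p + 1 + INR j) * binc (p + 1) j / INR (S j)).
  + field; apply INR_S_neq0.
  + rewrite <- binc_S; field; apply INR_S_neq0.
Qed.

(** For a natural number [q] this is the binomial coefficient of [q + j - 1] over
    [j]; Pascal's rule gives the bound by induction. *)
Lemma binc_nat_bound (q j : nat) : (Cmod (binc (INR q) j) <= 2 ^ (q + j))%R.
Proof.
revert j; induction q as [|q IHq]; intros j.
- destruct j as [|j].
  + rewrite binc_0, Cmod_1; simpl; lra.
  + replace (binc (INR 0) (S j)) with (RtoC 0).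
    * rewrite Cmod_0; apply pow_le; lra.
    * unfold binc; change (S j) with (1 + j)%nat; rewrite poch_add; simpl poch; simpl INR.
      field; exact (INR_fact_neq0 (S j)).
- induction j as [|j IHj].
  + rewrite binc_0, Cmod_1; apply pow_R1_Rle; lra.
  + rewrite INR_C_S in *; rewrite binc_pascal.
    eapply Rle_trans; [apply Cmod_triangle|].
    specialize (IHq (S j)).
    replace (S q + S j)%nat with (S (S (q + j))) by lia.
    replace (q + S j)%nat with (S (q + j)) in IHq by lia.
    replace (S q + j)%nat with (S (q + j)) in IHj by lia.
    change (2 ^ S (S (q + j)))%R with (2 * 2 ^ S (q + j))%R; lra.
Qed.

(** Uniformity in [p] is the point: the exponents [p + m n] of all terms of a
    substituted series must share one disc of convergence. *)
Lemma binc_bound (p : Complex.C) (q j : nat) :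
  (Cmod p <= INR q)%R -> (Cmod (binc p j) <= 2 ^ (q + j))%R.
Proof.
intros Hp; apply Rle_trans with (2 := binc_nat_bound q j).
unfold binc; rewrite !Cmod_div by apply INR_fact_neq0.
apply Rmult_le_compat_r;
  [apply Rlt_le, Rinv_0_lt_compat, Cmod_gt_0, INR_fact_neq0|].
induction j as [|j IH]; [simpl; lra|].
cbn [poch]; rewrite !Cmod_mult; apply Rmult_le_compat; auto using Cmod_ge_0.
eapply Rle_trans; [apply Cmod_triangle|].
rewrite <- INR_C_add, !Cmod_R, !(Rabs_pos_eq (INR _)) by apply pos_INR.
rewrite plus_INR; lra.
Qed.

(** * Hypergeometrization *)

Lemma hyp_taylor (a c : Complex.C) (f : Complex.C -> Complex.C) (u : nat -> Complex.C) :
  (forall n : nat, c <> - INR n) -> is_taylor f u ->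
  is_taylor (hyp a c f) (fun n => u n * (poch a n / poch c n)).
Proof.
intros hc Hf; unfold hyp; rewrite (taylor_eq f u Hf).
destruct (is_taylor_geom f u Hf) as (K & T & HK & HT & Hu).
destruct (poch_ratio_bound a c hc) as (D & HD & Hr).
apply CPSeries_taylor with K (T * D)%R; [nra|].
intros n; rewrite Cmod_mult, Rpow_mult_distr, <- Rmult_assoc.
specialize (Hu n); specialize (Hr n); rewrite Rmult_1_l in Hr.
apply Rmult_le_compat; auto using Cmod_ge_0.
Qed.

(** Through its Taylor coefficients, the operator depends on the germ only. *)
Lemma hyp_germ (a c : Complex.C) (f g : Complex.C -> Complex.C) :
  analytic0 f -> germ_eq f g -> hyp a c f = hyp a c g.
Proof.
intros [u Hf] E; unfold hyp.
now rewrite (taylor_eq f u Hf), (taylor_eq g u (is_taylor_germ f g u E Hf)).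
Qed.

(** What is needed of the inner function of [hyp_at] for the outer one to be
    determined. *)
Definition small_nonconstant (y : Complex.C -> Complex.C) : Prop :=
  (forall eps, (0 < eps)%R -> near0 (fun x => (Cmod (y x) < eps)%R)) /\
  near0 (fun x => x <> 0 -> y x <> 0).

(** The given [g] and the chosen outer function agree at the points [y x], which
    accumulate at 0, so they have the same Taylor coefficients. *)
Lemma hyp_at_factors (a c : Complex.C) (y f g : Complex.C -> Complex.C) :
  small_nonconstant y -> factors_by y f g ->
  hyp_at a c y f = fun x => hyp a c g (y x).
Proof.
intros [Hy0 Hy1] Hfg; unfold hyp_at.
assert (Ho : factors_by y f (outer y f))
  by (unfold outer; apply epsilon_spec; now exists g).
destruct Hfg as [[u Hu] Hg], Ho as [[v Hv] Ho].
assert (E : u = v).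
{ apply (taylor_unique_accum g (outer y f)); auto; intros eps Heps.
  assert (H : near0 (fun x => (Cmod (y x) < eps)%R /\ (x <> 0 -> y x <> 0) /\
      f x = g (y x) /\ f x = outer y f (y x)))
    by (repeat apply near0_and; auto).
  destruct (near0_exists _ 1 Rlt_0_1 H) as (x & Hx & _ & H1 & H2 & H3 & H4).
  exists (y x); rewrite <- H3; auto. }
subst v; unfold hyp; now rewrite (taylor_eq _ u Hu), (taylor_eq _ u Hv).
Qed.

(** * Complex powers near 1 *)

Lemma Cexp_add (z w : Complex.C) : Cexp (z + w) = Cexp z * Cexp w.
Proof.
destruct z as [a b], w as [c d]; unfold Cexp, Cplus, Cmult, Re, Im; simpl.
rewrite exp_plus, cos_plus, sin_plus; f_equal; ring.
Qed.

Lemma Cexp_0 : Cexp 0 = 1.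
Proof.
unfold Cexp, Re, Im, RtoC; simpl.
now rewrite exp_0, cos_0, sin_0, Rmult_1_l, Rmult_0_r.
Qed.

Lemma Clog_1 : Clog 1 = 0.
Proof.
unfold Clog; rewrite Cmod_1, ln_1; unfold Re, Im, RtoC; simpl.
now replace (0 / 1)%R with 0%R by field; rewrite atan_0.
Qed.

Lemma Re_pos_neq0 (u : Complex.C) : (0 < Re u)%R -> u <> 0.
Proof. intros H E; rewrite E in H; simpl in H; lra. Qed.

Lemma atan_acute (t : R) : (-1 < t < 1)%R -> (- PI / 4 < atan t < PI / 4)%R.
Proof.
intros Ht; rewrite <- atan_1.
replace (- PI / 4)%R with (atan (-1)); [split; apply atan_increasing; lra|].
replace (-1)%R with (- (1))%R by ring; rewrite atan_opp, atan_1; lra.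
Qed.

(** Both arguments lie in the open interval of half-width [PI / 4], so their
    sum does not leave the range of [atan]. *)
Lemma Clog_mult (u v : Complex.C) :
  (Rabs (Im u) < Re u)%R -> (Rabs (Im v) < Re v)%R ->
  Clog (u * v) = Clog u + Clog v.
Proof.
destruct u as [a b], v as [c d]; unfold Re, Im; simpl; intros Hu Hv.
assert (Ha : (0 < a)%R) by (pose proof (Rabs_pos b); lra).
assert (Hc : (0 < c)%R) by (pose proof (Rabs_pos d); lra).
apply Rabs_def2 in Hu; apply Rabs_def2 in Hv.
assert (Hp : forall p q, (0 < p -> 0 < Cmod (p, q))%R).
{ intros p q Hp; apply Cmod_gt_0; apply Re_pos_neq0; exact Hp. }
unfold Clog; rewrite Cmod_mult, ln_mult by auto.
unfold Cplus, Re, Im; simpl; f_equal.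
assert (Tb : (-1 < b / a < 1)%R).
{ split; [apply Rmult_lt_reg_r with a | apply Rmult_lt_reg_r with a]; auto;
  unfold Rdiv; rewrite ?Rmult_assoc, ?Rinv_l by lra; lra. }
assert (Td : (-1 < d / c < 1)%R).
{ split; [apply Rmult_lt_reg_r with c | apply Rmult_lt_reg_r with c]; auto;
  unfold Rdiv; rewrite ?Rmult_assoc, ?Rinv_l by lra; lra. }
pose proof (atan_acute _ Tb) as Ab; pose proof (atan_acute _ Td) as Ad.
pose proof PI_RGT_0.
assert (Hcos : forall t, (- PI / 2 < t < PI / 2)%R -> cos t <> 0%R).
{ intros t Ht; apply Rgt_not_eq, cos_gt_0; lra. }
assert (Hprod : (0 < 1 - b / a * (d / c))%R) by nra.
rewrite <- (atan_tan (atan (b / a) + atan (d / c))) by lra.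
rewrite tan_plus; rewrite ?tan_atan; try (apply Hcos; lra); [|lra].
f_equal; field; repeat split; try lra.
assert (0 < a * c * (1 - b / a * (d / c)))%R by (repeat apply Rmult_lt_0_compat; lra).
replace (a * c * (1 - b / a * (d / c)))%R with (a * c - b * d)%R in H0 by (field; lra).
lra.
Qed.

Lemma Cpower_mult (u v s : Complex.C) :
  (Rabs (Im u) < Re u)%R -> (Rabs (Im v) < Re v)%R ->
  Cpower (u * v) s = Cpower u s * Cpower v s.
Proof.
intros Hu Hv; unfold Cpower; rewrite Clog_mult by assumption.
now rewrite Cmult_plus_distr_l, Cexp_add.
Qed.

Lemma Cpower_add (u s t : Complex.C) : Cpower u (s + t) = Cpower u s * Cpower u t.
Proof. unfold Cpower; now rewrite Cmult_plus_distr_r, Cexp_add. Qed.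

Lemma Cpower_0 (u : Complex.C) : Cpower u 0 = 1.
Proof. unfold Cpower; now rewrite Cmult_0_l, Cexp_0. Qed.

Lemma Cpower_opp (u s : Complex.C) : Cpower u s * Cpower u (- s) = 1.
Proof. rewrite <- Cpower_add, Cplus_opp_r; apply Cpower_0. Qed.

Lemma Cpower_nat (u : Complex.C) (n : nat) : (0 < Re u)%R -> Cpower u (INR n) = u ^ n.
Proof.
intros Hu; induction n as [|n IH]; [apply Cpower_0|].
rewrite INR_C_S, Cpower_add, IH, Cpow_S.
unfold Cpower; rewrite Cmult_1_l, Cexp_Clog by assumption; ring.
Qed.

Lemma Cpower_opp_nat (u p : Complex.C) (n : nat) :
  (0 < Re u)%R -> Cpower u (- (p + INR n)) = Cpower u (- p) * (/ u) ^ n.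
Proof.
intros Hu; pose proof (Re_pos_neq0 u Hu) as Hn.
rewrite Copp_plus_distr, Cpower_add; f_equal.
rewrite Cpow_inv by assumption; rewrite <- Cpower_nat by assumption.
pose proof (Cpower_opp u (INR n)) as E.
assert (Cpower u (INR n) <> 0) by (rewrite Cpower_nat by assumption; now apply Cpow_nz).
replace (Cpower u (- INR n)) with (Cpower u (INR n) * Cpower u (- INR n) / Cpower u (INR n))
  by (field; assumption).
rewrite E; field; assumption.
Qed.

Lemma near1_bounds (v : Complex.C) :
  (Cmod v < / 2)%R -> (Rabs (Im (1 - v)) < Re (1 - v))%R.
Proof.
intros Hv; destruct v as [a b]; pose proof (Rmax_Cmod (a, b)) as H; simpl in H.
pose proof (Rmax_l (Rabs a) (Rabs b)); pose proof (Rmax_r (Rabs a) (Rabs b)).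
assert (Ha : (Rabs a < / 2)%R) by lra; assert (Hb : (Rabs b < / 2)%R) by lra.
apply Rabs_def2 in Ha; unfold Re, Im; simpl.
replace (0 + - b)%R with (- b)%R by ring; rewrite Rabs_Ropp; lra.
Qed.

Lemma near1_Re (v : Complex.C) : (Cmod v < / 2)%R -> (0 < Re (1 - v))%R.
Proof.
intros Hv; pose proof (near1_bounds v Hv); pose proof (Rabs_pos (Im (1 - v))); lra.
Qed.

(** The half-cone [|Im u| < Re u] is stable under inversion, so [Clog_mult] applies
    to [u * / u = 1]. *)
Lemma Cpower_inv (u s : Complex.C) :
  (Rabs (Im u) < Re u)%R -> Cpower (/ u) s = Cpower u (- s).
Proof.
intros Hu.
assert (Hr : (0 < Re u)%R) by (pose proof (Rabs_pos (Im u)); lra).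
pose proof (Re_pos_neq0 u Hr) as Hn.
assert (Hi : (Rabs (Im (/ u)) < Re (/ u))%R).
{ destruct u as [a b]; unfold Re, Im in *; simpl in *.
  assert (0 < a * (a * 1) + b * (b * 1))%R by nra.
  unfold Rdiv; rewrite Rabs_mult, Rabs_Ropp, (Rabs_pos_eq (/ _)) by
    (apply Rlt_le, Rinv_0_lt_compat; lra).
  apply Rmult_lt_compat_r; [apply Rinv_0_lt_compat; lra | lra]. }
pose proof (Cpower_mult u (/ u) s Hu Hi) as E.
rewrite Cinv_r, Cpower_1 in E by assumption.
transitivity (Cpower u (- s) * (Cpower u s * Cpower (/ u) s)); [|rewrite <- E; ring].
pose proof (Cpower_opp u s) as E'.
replace (Cpower u (- s) * (Cpower u s * Cpower (/ u) s))
  with ((Cpower u s * Cpower u (- s)) * Cpower (/ u) s) by ring.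
rewrite E'; ring.
Qed.

(** * The binomial series *)

Lemma is_derive_mult_combination (e : R) (f1 f2 g1 g2 : R -> R) (t l1 l2 m1 m2 : R) :
  is_derive f1 t l1 -> is_derive f2 t l2 -> is_derive g1 t m1 -> is_derive g2 t m2 ->
  is_derive (fun s => f1 s * g1 s + e * (f2 s * g2 s))%R t
    (l1 * g1 t + f1 t * m1 + e * (l2 * g2 t + f2 t * m2))%R.
Proof.
intros F1 F2 G1 G2; auto_derive; [repeat split; eexists; eassumption|].
rewrite (is_derive_unique (fun x : R => f1 x) _ _ F1), (is_derive_unique (fun x : R => f2 x) _ _ F2),
  (is_derive_unique (fun x : R => g1 x) _ _ G1), (is_derive_unique (fun x : R => g2 x) _ _ G2); ring.
Qed.

Lemma is_derive_exp_mult (h h' f1 f2 : R -> R) (t l1 l2 : R) :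
  (forall s, is_derive h s (h' s)) -> is_derive f1 t l1 -> is_derive f2 t l2 ->
  is_derive (fun s => exp (f1 s) * h (f2 s))%R t
    (exp (f1 t) * (l1 * h (f2 t) + l2 * h' (f2 t)))%R.
Proof.
intros H F1 F2; auto_derive; [repeat split; eexists; try eassumption; apply H|].
rewrite (is_derive_unique (fun x : R => f1 x) _ _ F1), (is_derive_unique (fun x : R => f2 x) _ _ F2),
  (is_derive_unique (fun x : R => h x) _ _ (H _)); ring.
Qed.

(** Componentwise, because the parameter is real and constancy is to be deduced
    from a vanishing derivative on a segment. *)
Definition Cderiv (f : R -> Complex.C) (t : R) (l : Complex.C) : Prop :=
  is_derive (fun s => Re (f s)) t (Re l) /\ is_derive (fun s => Im (f s)) t (Im l).

Lemma Cderiv_value (f : R -> Complex.C) (t : R) (l m : Complex.C) :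
  l = m -> Cderiv f t l -> Cderiv f t m.
Proof. now intros ->. Qed.

Lemma Cderiv_mult (f g : R -> Complex.C) (t : R) (l m : Complex.C) :
  Cderiv f t l -> Cderiv g t m -> Cderiv (fun s => f s * g s) t (l * g t + f t * m).
Proof.
intros [F1 F2] [G1 G2]; split.
- evar_last.
  + eapply is_derive_ext; [|exact (is_derive_mult_combination (-1) _ _ _ _ _ _ _ _ _ F1 F2 G1 G2)].
    intros s; unfold Re, Im; simpl; ring.
  + unfold Re, Im; simpl; ring.
- evar_last.
  + eapply is_derive_ext; [|exact (is_derive_mult_combination 1 _ _ _ _ _ _ _ _ _ F1 F2 G2 G1)].
    intros s; unfold Re, Im; simpl; ring.
  + unfold Re, Im; simpl; ring.
Qed.

Lemma Cderiv_const (z : Complex.C) (t : R) : Cderiv (fun _ => z) t 0.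
Proof. split; apply (@is_derive_const R_AbsRing R_NormedModule). Qed.

Lemma Cderiv_exp (f : R -> Complex.C) (t : R) (l : Complex.C) :
  Cderiv f t l -> Cderiv (fun s => Cexp (f s)) t (l * Cexp (f t)).
Proof.
intros [F1 F2]; split.
- evar_last.
  + exact (is_derive_exp_mult cos (fun s => - sin s)%R _ _ _ _ _ is_derive_cos F1 F2).
  + unfold Cexp, Re, Im; simpl; ring.
- evar_last.
  + exact (is_derive_exp_mult sin cos _ _ _ _ _ is_derive_sin F1 F2).
  + unfold Cexp, Re, Im; simpl; ring.
Qed.

Lemma Cderiv_log (x : Complex.C) (t : R) :
  (0 < Re (1 - t * x))%R -> Cderiv (fun s => Clog (1 - s * x)) t (- x / (1 - t * x)).
Proof.
destruct x as [p q]; unfold Re; simpl; intros Ht.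
replace (1 + - (t * p - 0 * q))%R with (1 - t * p)%R in Ht by ring.
set (D := ((1 - t * p) ^ 2 + (t * q) ^ 2)%R).
assert (HD : (0 < D)%R) by (unfold D; nra).
split.
- apply is_derive_ext with (fun s => (ln (sqrt ((1 - s * p) ^ 2 + (s * q) ^ 2)))%R).
  { intros s; unfold Clog, Cmod, Re, Im; simpl; f_equal; f_equal; ring. }
  auto_derive.
  + fold D; repeat split; auto; try (apply sqrt_lt_R0); fold D; auto.
  + match goal with |- context [sqrt ?e] =>
      replace e with D by (unfold D; ring) end.
    transitivity ((- p * (1 - t * p) + q * (t * q)) / D)%R.
    * rewrite <- (sqrt_sqrt D) at 3 by lra.
      assert (0 < sqrt D)%R by (apply sqrt_lt_R0; assumption).
      field; lra.
    * unfold D in *; unfold Re; simpl; field; nra.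
- apply is_derive_ext with (fun s => atan (- (s * q) / (1 - s * p))).
  { intros s; unfold Clog, Cmod, Re, Im; simpl; f_equal; f_equal; ring. }
  auto_derive.
  + lra.
  + unfold D in *; unfold Im; simpl; field; repeat split; nra.
Qed.

Lemma Csum_components (a : nat -> Complex.C) (n : nat) :
  Csum a n = (sum_n (fun k => Re (a k)) n, sum_n (fun k => Im (a k)) n).
Proof.
induction n as [|n IH].
- rewrite Csum_0, !sum_O; now destruct (a 0%nat).
- rewrite Csum_S, IH, !sum_Sn; now destruct (a (S n)).
Qed.

Lemma pseries_eps (a : nat -> R) (x l : R) :
  is_pseries a x l -> forall eps : R, (0 < eps)%R -> exists N, forall n, (N <= n)%nat ->
    (Rabs (sum_n (fun k => a k * x ^ k) n - l) < eps)%R.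
Proof.
intros H eps Heps; apply is_pseries_R in H.
destruct (proj1 (filterlim_locally_ball_norm (K := R_AbsRing) (U := R_NormedModule)
    (F := Hierarchy.eventually) _ _) H (mkposreal eps Heps)) as [N HN].
exists N; exact HN.
Qed.

Lemma Cmod_components (x y : R) : (Cmod (x, y) <= Rabs x + Rabs y)%R.
Proof.
replace (x, y) with (RtoC x + Ci * RtoC y)
  by (unfold RtoC, Ci, Cplus, Cmult; simpl; f_equal; ring).
eapply Rle_trans; [apply Cmod_triangle|].
rewrite Cmod_mult, Cmod_Ci, !Cmod_R; lra.
Qed.

Lemma Cpseries_components (a : nat -> Complex.C) (t l m : R) :
  is_pseries (fun k => Re (a k)) t l -> is_pseries (fun k => Im (a k)) t m ->
  Cpseries a (RtoC t) (l, m).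
Proof.
intros Hl Hm; apply (proj2 (Cpseries_eps _ _ _)); intros eps Heps.
destruct (pseries_eps _ _ _ Hl (eps / 2)%R ltac:(lra)) as [N1 H1].
destruct (pseries_eps _ _ _ Hm (eps / 2)%R ltac:(lra)) as [N2 H2].
exists (N1 + N2)%nat; intros n Hn.
specialize (H1 n ltac:(lia)); specialize (H2 n ltac:(lia)).
rewrite Csum_components.
eapply Rle_lt_trans; [apply Cmod_components|].
replace eps with (eps / 2 + eps / 2)%R by field.
apply Rplus_lt_compat; [eapply Rle_lt_trans; [|exact H1] | eapply Rle_lt_trans; [|exact H2]];
  right; simpl; unfold Rminus; do 2 f_equal; apply sum_n_ext; intros k;
  rewrite <- RtoC_pow; unfold Re, Im; simpl; ring.
Qed.

Definition binomial_term (p x : Complex.C) (k : nat) : Complex.C := binc p k * x ^ k.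

(** The binomial series at [t * x] for real [t], as a pair of real power series in
    [t]: these can be differentiated term by term. *)
Definition binomial_curve (p x : Complex.C) (t : R) : Complex.C :=
  (PSeries (fun k => Re (binomial_term p x k)) t,
   PSeries (fun k => Im (binomial_term p x k)) t).

Definition binomial_velocity (p x : Complex.C) (t : R) : Complex.C :=
  (PSeries (PS_derive (fun k => Re (binomial_term p x k))) t,
   PSeries (PS_derive (fun k => Im (binomial_term p x k))) t).

Definition velocity_coefs (p x : Complex.C) (k : nat) : Complex.C :=
  INR (S k) * binomial_term p x (S k).

(** The terms are bounded by a multiple of [(2 * |x|) ^ k], so the real and
    imaginary parts converge beyond [1]. *)
Lemma binomial_radius (p x : Complex.C) (part : Complex.C -> R) (t : R) :
  (Cmod x < / 2)%R -> (forall z, (Rabs (part z) <= Cmod z)%R) -> (0 <= t <= 1)%R ->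
  Rbar_lt (Rabs t) (CV_radius (fun k => part (binomial_term p x k))).
Proof.
intros Hx Hpart Ht.
(* A radius [r > 1] such that [2 * |x| * r <= 1]. *)
set (r := (2 / (1 + 2 * Cmod x))%R).
pose proof (Cmod_ge_0 x) as H0.
assert (Hr1 : (1 < r)%R).
{ unfold r; apply Rmult_lt_reg_r with (1 + 2 * Cmod x)%R; [lra|].
  unfold Rdiv; rewrite Rmult_assoc, Rinv_l by lra; lra. }
apply Rbar_lt_le_trans with (Finite r).
{ simpl; rewrite Rabs_pos_eq by lra; lra. }
apply (proj1 (CV_radius_bounded (fun k => part (binomial_term p x k)))).
destruct (INR_unbounded (Cmod p)) as [q Hq].
exists (2 ^ q)%R; intros n.
rewrite Rabs_mult, (Rabs_pos_eq (r ^ n)) by (apply pow_le; lra).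
apply Rle_trans with (Cmod (binomial_term p x n) * r ^ n)%R.
{ apply Rmult_le_compat_r; [apply pow_le; lra | apply Hpart]. }
unfold binomial_term; rewrite Cmod_mult, Cmod_pow.
apply Rle_trans with (2 ^ (q + n) * Cmod x ^ n * r ^ n)%R.
{ apply Rmult_le_compat_r; [apply pow_le; lra|].
  apply Rmult_le_compat_r; [apply pow_le; lra|].
  apply binc_bound; lra. }
rewrite pow_add, !Rmult_assoc, <- Rpow_mult_distr, <- Rpow_mult_distr.
rewrite <- (Rmult_1_r (2 ^ q)) at 2.
apply Rmult_le_compat_l; [apply pow_le; lra|].
rewrite <- (pow1 n); apply pow_incr; split.
- apply Rmult_le_pos; [|apply Rmult_le_pos]; lra.
- unfold r; apply Rmult_le_reg_r with (1 + 2 * Cmod x)%R; [lra|].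
  replace (2 * (Cmod x * (2 / (1 + 2 * Cmod x))) * (1 + 2 * Cmod x))%R
    with (4 * Cmod x)%R by (field; lra).
  lra.
Qed.

Lemma Rabs_Im_le_Cmod (z : Complex.C) : (Rabs (Im z) <= Cmod z)%R.
Proof. eapply Rle_trans; [apply Rmax_r | apply Rmax_Cmod]. Qed.

Lemma binomial_curve_series (p x : Complex.C) (t : R) :
  (Cmod x < / 2)%R -> (0 <= t <= 1)%R ->
  Cpseries (binomial_term p x) (RtoC t) (binomial_curve p x t).
Proof.
intros Hx Ht; apply Cpseries_components; apply PSeries_correct, CV_radius_inside,
  binomial_radius; auto using re_le_Cmod, Rabs_Im_le_Cmod.
Qed.

Lemma binomial_velocity_series (p x : Complex.C) (t : R) :
  (Cmod x < / 2)%R -> (0 <= t <= 1)%R ->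
  Cpseries (velocity_coefs p x) (RtoC t) (binomial_velocity p x t).
Proof.
intros Hx Ht; apply Cpseries_components.
- assert (E : forall k, PS_derive (fun k => Re (binomial_term p x k)) k
    = Re (velocity_coefs p x k)).
  { intros k; unfold PS_derive, velocity_coefs, Re, Im; simpl; ring. }
  apply (is_pseries_ext _ _ _ _ E), PSeries_correct, ex_pseries_derive, binomial_radius;
    auto using re_le_Cmod.
- assert (E : forall k, PS_derive (fun k => Im (binomial_term p x k)) k
    = Im (velocity_coefs p x k)).
  { intros k; unfold PS_derive, velocity_coefs, Re, Im; simpl; ring. }
  apply (is_pseries_ext _ _ _ _ E), PSeries_correct, ex_pseries_derive, binomial_radius;
    auto using Rabs_Im_le_Cmod.
Qed.

(** The coefficient recurrence [binc_S] read as a differential equation along the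
    segment from [0] to [x]. *)
Lemma binomial_ode (p x : Complex.C) (t : R) :
  (Cmod x < / 2)%R -> (0 <= t <= 1)%R ->
  (1 - t * x) * binomial_velocity p x t = p * x * binomial_curve p x t.
Proof.
intros Hx Ht.
set (s := binomial_term p x); set (d := velocity_coefs p x).
set (S0 := binomial_curve p x t); set (S1 := binomial_velocity p x t).
assert (E : S1 = p * x * S0 + x * (t * S1)).
{ apply (Cpseries_unique d (RtoC t)); [now apply binomial_velocity_series|].
  apply Cpseries_ext with (fun k => p * x * s k +
    x * (if le_lt_dec 1 k then d (k - 1)%nat else RtoC 0)).
  - intros k; unfold d, velocity_coefs, s, binomial_term.
    rewrite (Cmult_assoc (INR (S k))), binc_S.
    destruct (le_lt_dec 1 k) as [h|h].
    + replace (S (k - 1)) with k by lia; rewrite Cpow_S; ring.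
    + replace k with 0%nat by lia; simpl; ring.
  - apply (@is_pseries_plus C_AbsRing C_NormedModule (fun k => p * x * s k)
      (fun k => x * (if le_lt_dec 1 k then d (k - 1)%nat else RtoC 0))).
    + apply (@is_pseries_scal C_AbsRing C_NormedModule (p * x)); [apply Cmult_comm|].
      now apply binomial_curve_series.
    + apply (@is_pseries_scal C_AbsRing C_NormedModule x); [apply Cmult_comm|].
      replace (t * S1) with (RtoC t ^ 1 * S1) by (rewrite Cpow_1_r; reflexivity).
      apply (Cpseries_shift d 1); now apply binomial_velocity_series. }
replace (p * x * S0) with (p * x * S0 + x * (t * S1) - t * x * S1) by ring.
rewrite <- E; ring.
Qed.

(** By the differential equation the product of the series with
    [(1 - t * x) ^ p] has zero derivative along the segment, and it is 1 at
    the origin. *)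
Lemma binomial_series (p x : Complex.C) :
  (Cmod x < / 2)%R -> Cpseries (binc p) x (Cpower (1 - x) (- p)).
Proof.
intros Hx; set (S0 := binomial_curve p x); set (S1 := binomial_velocity p x).
set (E t := Cexp (p * Clog (1 - RtoC t * x))).
assert (Hre : forall t, (0 <= t <= 1)%R -> (0 < Re (1 - RtoC t * x))%R).
{ intros t Ht; apply near1_Re; rewrite Cmod_mult, Cmod_R, Rabs_pos_eq by lra.
  pose proof (Cmod_ge_0 x); nra. }
assert (D : forall t, (0 <= t <= 1)%R -> Cderiv (fun t => S0 t * E t) t 0).
{ intros t Ht; pose proof (Re_pos_neq0 _ (Hre t Ht)) as Hn.
  apply (Cderiv_value _ _ (S1 t * E t + S0 t * (p * (- x / (1 - t * x)) * E t))).
  - replace (S1 t) with ((1 - t * x) * S1 t / (1 - t * x)) by (field; assumption).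
    unfold S1; rewrite binomial_ode by assumption; fold S0; field; assumption.
  - apply Cderiv_mult.
    + split; apply is_derive_PSeries, binomial_radius;
        auto using re_le_Cmod, Rabs_Im_le_Cmod.
    + apply (Cderiv_exp (fun t => p * Clog (1 - RtoC t * x))).
      apply (Cderiv_value _ _ (0 * Clog (1 - t * x) + p * (- x / (1 - t * x)))); [ring|].
      apply (Cderiv_mult (fun _ => p)); [apply Cderiv_const | apply Cderiv_log; auto]. }
assert (C : S0 0 * E 0%R = S0 1 * E 1%R).
{ apply injective_projections.
  - apply (eq_is_derive (fun t => Re (S0 t * E t)) 0 1); [intros t Ht; apply D, Ht | lra].
  - apply (eq_is_derive (fun t => Im (S0 t * E t)) 0 1); [intros t Ht; apply D, Ht | lra]. }
assert (H0 : S0 0 * E 0%R = 1).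
{ unfold S0, binomial_curve, E; rewrite !PSeries_0.
  replace (1 - RtoC 0 * x) with (RtoC 1) by ring.
  rewrite Clog_1, Cmult_0_r, Cexp_0.
  unfold binomial_term; rewrite binc_0; unfold Re, Im; simpl.
  unfold RtoC, Cmult; simpl; f_equal; ring. }
assert (E1 : E 1%R = Cpower (1 - x) p) by (unfold E, Cpower; now rewrite Cmult_1_l).
assert (F : S0 1 = Cpower (1 - x) (- p)).
{ transitivity (S0 1 * E 1%R * Cpower (1 - x) (- p)).
  - rewrite E1, <- Cmult_assoc, Cpower_opp; ring.
  - rewrite <- C, H0; ring. }
rewrite <- F; apply Cpseries_same_terms with (2 := binomial_curve_series p x 1 Hx ltac:(lra)).
intros k; unfold binomial_term; rewrite Cpow_1_l; ring.
Qed.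

(** * Weighted substitutions *)

Definition subst_arg (lam kap : Complex.C) (m : nat) (x : Complex.C) : Complex.C :=
  kap * (x / (1 - lam * x)) ^ m.

Definition weighted (lam kap : Complex.C) (m : nat) (p : Complex.C)
    (k : Complex.C -> Complex.C) (x : Complex.C) : Complex.C :=
  Cpower (1 - lam * x) (- p) * k (subst_arg lam kap m x).

(** The contribution of the [n]-th coefficient [u n] to the coefficient of
    [x ^ N]. *)
Definition weighted_term (lam kap : Complex.C) (m : nat) (p : Complex.C)
    (u : nat -> Complex.C) (n N : nat) : Complex.C :=
  u n * kap ^ n *
  (if le_lt_dec (m * n) N
   then binc (p + INR (m * n)) (N - m * n) * lam ^ (N - m * n) else RtoC 0).

Definition weighted_coefs (lam kap : Complex.C) (m : nat) (p : Complex.C)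
    (u : nat -> Complex.C) (N : nat) : Complex.C :=
  Csum (fun n => weighted_term lam kap m p u n N) N.

Lemma near0_small (d : R) : (0 < d)%R -> near0 (fun x => (Cmod x < d)%R).
Proof. intros Hd; exists d; auto. Qed.

Lemma near0_scal_small (z : Complex.C) (d : R) :
  (0 < d)%R -> near0 (fun x => (Cmod (z * x)%C < d)%R).
Proof.
intros Hd; pose proof (Cmod_ge_0 z) as Hz.
apply near0_imp with (2 := near0_small (d / (Cmod z + 1)) ltac:(apply Rdiv_lt_0_compat; lra)).
intros x Hx; rewrite Cmod_mult.
apply Rle_lt_trans with ((Cmod z + 1) * Cmod x)%R.
- apply Rmult_le_compat_r; [apply Cmod_ge_0 | lra].
- apply Rlt_le_trans with ((Cmod z + 1) * (d / (Cmod z + 1)))%R;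
    [apply Rmult_lt_compat_l; lra | right; field; lra].
Qed.

Lemma near0_unit (lam : Complex.C) : near0 (fun x => 1 - lam * x <> 0).
Proof.
apply near0_imp with (2 := near0_scal_small lam (/ 2) ltac:(lra)).
intros x Hx; apply Re_pos_neq0, near1_Re, Hx.
Qed.

Lemma pow_small (r : R) (m : nat) : (1 <= m)%nat -> (0 <= r <= 1)%R -> (r ^ m <= r)%R.
Proof.
intros Hm Hr; destruct m as [|m]; [lia|]; simpl.
apply Rle_trans with (r * 1)%R; [|lra]; apply Rmult_le_compat_l; [lra|].
rewrite <- (pow1 m); now apply pow_incr.
Qed.

Lemma subst_arg_small (lam kap : Complex.C) (m : nat) (d : R) :
  (1 <= m)%nat -> (0 < d)%R -> near0 (fun x => (Cmod (subst_arg lam kap m x) < d)%R).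
Proof.
intros Hm Hd; set (e := Rmin 1 (d / (Cmod kap + 1))).
pose proof (Cmod_ge_0 kap) as Hk.
assert (He : (0 < e)%R) by (apply Rmin_pos; [|apply Rdiv_lt_0_compat]; lra).
generalize (near0_and _ _ (near0_scal_small lam (/ 2) ltac:(lra)) (near0_small (e / 2) ltac:(lra))).
apply near0_imp; intros x [H1 H2].
pose proof (Re_pos_neq0 _ (near1_Re _ H1)) as Hn.
assert (Hc : (/ 2 <= Cmod (1 - lam * x)%C)%R).
{ pose proof (Cmod_triangle (1 - lam * x) (lam * x)) as H.
  replace (1 - lam * x + lam * x) with (RtoC 1) in H by ring; rewrite Cmod_1 in H; lra. }
assert (Hq : (Cmod (x / (1 - lam * x))%C <= e)%R).
{ rewrite Cmod_div by assumption.
  apply Rmult_le_reg_r with (Cmod (1 - lam * x)%C); [lra|].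
  unfold Rdiv; rewrite Rmult_assoc, Rinv_l by lra. nra. }
pose proof (Cmod_ge_0 (x / (1 - lam * x))) as Hq0.
assert (He1 : (e <= 1)%R) by apply Rmin_l.
assert (He2 : (e <= d / (Cmod kap + 1))%R) by apply Rmin_r.
unfold subst_arg; rewrite Cmod_mult, Cmod_pow.
apply Rle_lt_trans with (Cmod kap * (d / (Cmod kap + 1)))%R.
- apply Rmult_le_compat_l; [assumption|].
  eapply Rle_trans; [apply pow_small; [assumption|] |]; lra.
- apply Rmult_lt_reg_r with (Cmod kap + 1)%R; [lra|].
  replace (Cmod kap * (d / (Cmod kap + 1)) * (Cmod kap + 1))%R with (Cmod kap * d)%R by (field; lra).
  nra.
Qed.

Lemma subst_arg_neq0 (lam kap : Complex.C) (m : nat) (x : Complex.C) :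
  kap <> 0 -> 1 - lam * x <> 0 -> x <> 0 -> subst_arg lam kap m x <> 0.
Proof.
intros Hk Hn Hx; unfold subst_arg; apply Cmult_neq_0; [assumption|].
apply Cpow_nz; unfold Cdiv; apply Cmult_neq_0; [assumption|].
intros E; apply C1_nz; rewrite <- (Cinv_r (1 - lam * x)), E by assumption; ring.
Qed.

Lemma subst_arg_small_nonconstant (lam kap : Complex.C) (m : nat) (y : Complex.C -> Complex.C) :
  (1 <= m)%nat -> kap <> 0 -> germ_eq (subst_arg lam kap m) y -> small_nonconstant y.
Proof.
intros Hm Hk Hy; split.
- intros eps Heps; generalize (near0_and _ _ Hy (subst_arg_small lam kap m eps Hm Heps)).
  apply near0_imp; intros x [<- H]; exact H.
- generalize (near0_and _ _ Hy (near0_unit lam)).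
  apply near0_imp; intros x [<- H] Hx; now apply subst_arg_neq0.
Qed.

(** As [m >= 1], a nonzero term has [n <= N], so powers with exponent [n] are
    dominated by powers with exponent [N]. *)
Lemma weighted_term_bound (lam kap : Complex.C) (m : nat) (p : Complex.C)
    (u : nat -> Complex.C) (K T : R) :
  (1 <= m)%nat -> (0 < K)%R -> (1 <= T)%R -> geom_bound K T u ->
  exists K' T', (0 <= K')%R /\ (1 <= T')%R /\
    forall n, geom_bound K' T' (weighted_term lam kap m p u n).
Proof.
intros Hm HK HT Hu.
destruct (INR_unbounded (Cmod p)) as [q Hq].
set (k1 := Rmax 1 (Cmod kap)); set (l1 := Rmax 1 (Cmod lam)).
assert (Hk : (1 <= k1)%R) by apply Rmax_l; assert (Hl : (1 <= l1)%R) by apply Rmax_l.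
assert (Hq0 : (0 < 2 ^ q)%R) by (apply pow_lt; lra).
exists (K * 2 ^ q)%R, (T * k1 * (2 * l1))%R; split; [nra|]; split.
{ assert (1 <= T * k1)%R by nra; nra. }
intros n N; unfold weighted_term.
destruct (le_lt_dec (m * n) N) as [h|h].
- assert (HnN : (n <= N)%nat) by nia.
  assert (Hup : forall r, (1 <= r)%R -> (r ^ n <= r ^ N)%R) by (intros; now apply Rle_pow).
  rewrite !Cmod_mult, !Cmod_pow, !Rpow_mult_distr.
  apply Rle_trans with ((K * T ^ N * k1 ^ N) * (2 ^ (q + N) * l1 ^ N))%R;
    [|right; rewrite pow_add; ring].
  apply Rmult_le_compat; try (repeat apply Rmult_le_pos; auto using Cmod_ge_0, pow_le).
  + apply Rmult_le_compat; auto using Cmod_ge_0, pow_le.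
    * eapply Rle_trans; [apply Hu|]; apply Rmult_le_compat_l; [lra | auto].
    * apply Rle_trans with (k1 ^ n)%R; [|auto].
      apply pow_incr; split; [apply Cmod_ge_0 | apply Rmax_r].
  + apply Rmult_le_compat; auto using Cmod_ge_0, pow_le.
    * replace (q + N)%nat with ((q + m * n) + (N - m * n))%nat by lia.
      apply binc_bound; eapply Rle_trans; [apply Cmod_triangle|].
      rewrite Cmod_R, Rabs_pos_eq, plus_INR by apply pos_INR; lra.
    * apply Rle_trans with (l1 ^ (N - m * n))%R.
      -- apply pow_incr; split; [apply Cmod_ge_0 | apply Rmax_r].
      -- apply Rle_pow; [assumption | lia].
- rewrite Cmult_0_r, Cmod_0; apply Rmult_le_pos; [nra|].
  apply pow_le; assert (1 <= T * k1)%R by nra; nra.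
Qed.

(** Each power [(x / (1 - lam x)) ^ (m n)] is absorbed in the weight, which
    becomes [(1 - lam x) ^ - (p + m n)] and is expanded by the binomial series. *)
Lemma weighted_taylor (lam kap : Complex.C) (m : nat) (p : Complex.C)
    (k : Complex.C -> Complex.C) (u : nat -> Complex.C) :
  (1 <= m)%nat -> is_taylor k u ->
  is_taylor (weighted lam kap m p k) (weighted_coefs lam kap m p u).
Proof.
intros Hm Hk.
destruct (is_taylor_geom k u Hk) as (K & T & HK & HT & Hu).
destruct (weighted_term_bound lam kap m p u K T Hm HK HT Hu) as (K' & T' & HK' & HT' & HB).
destruct Hk as (d & Hd & Hk).
generalize (near0_and _ _ (near0_scal_small lam (/ 2) ltac:(lra))
  (near0_and _ _ (subst_arg_small lam kap m d Hm Hd)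
    (near0_small (/ (4 * T')) ltac:(apply Rinv_0_lt_compat; lra)))).
apply near0_imp; intros x (H1 & H2 & H3).
specialize (Hk _ H2).
pose proof (near1_Re _ H1) as Hre; pose proof (Re_pos_neq0 _ Hre) as Hn.
unfold weighted_coefs.
apply Cpseries_triangular with (K := K') (T := T') (rs :=
  fun n => u n * kap ^ n * (x ^ (m * n) * Cpower (1 - lam * x) (- (p + INR (m * n))))); auto.
- lra.
- intros n N h; unfold weighted_term.
  destruct (le_lt_dec (m * n) N) as [h'|]; [nia | ring].
- apply Rmult_le_reg_l with (/ T')%R; [apply Rinv_0_lt_compat; lra|].
  rewrite <- Rmult_assoc, Rinv_l, Rmult_1_l by lra.
  rewrite <- Rinv_mult, Rmult_comm; lra.
- intros n; unfold weighted_term.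
  apply Cpseries_ext with (fun N => u n * kap ^ n *
    (if le_lt_dec (m * n) N then (fun j => binc (p + INR (m * n)) j * lam ^ j) (N - m * n)%nat
     else RtoC 0)); [reflexivity|].
  apply (@is_pseries_scal C_AbsRing C_NormedModule (u n * kap ^ n)); [apply Cmult_comm|].
  apply (Cpseries_shift (fun j => binc (p + INR (m * n)) j * lam ^ j)).
  apply Cpseries_same_terms with (2 := binomial_series (p + INR (m * n)) (lam * x) H1).
  intros j; rewrite Cpow_mult_l; ring.
(* The row sums form the series of [k] times the weight, read as a series at the
   point 1. *)
- unfold weighted; set (w := Cpower (1 - lam * x) (- p)).
  apply Cpseries_same_terms with (fun n => w * u n) (subst_arg lam kap m x).
  + intros j; rewrite Cpower_opp_nat by assumption; fold w; unfold subst_arg.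
    rewrite Cpow_1_l, Cpow_mult_l, <- Cpow_mult_r; unfold Cdiv; rewrite Cpow_mult_l; ring.
  + apply (@is_pseries_scal C_AbsRing C_NormedModule w); [apply Cmult_comm | exact Hk].
Qed.

(** * Intertwining *)

Lemma binc_ratio (a c : Complex.C) (d j : nat) :
  (forall n : nat, c <> - INR n) ->
  binc (c + INR d) j * (poch a (d + j) / poch c (d + j))
  = poch a d / poch c d * binc (a + INR d) j.
Proof.
intros hc; pose proof (poch_neq0 c hc (d + j)) as H.
rewrite poch_add in H.
assert (H1 : poch c d <> 0) by (intros E; apply H; rewrite E; ring).
assert (H2 : poch (c + INR d) j <> 0) by (intros E; apply H; rewrite E; ring).
unfold binc; rewrite !poch_add; field; auto using INR_fact_neq0.
Qed.

(** With the weight [(1 - lam x) ^ - c] the factor [(c)_N] of the operator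
    cancels against the binomial coefficients of the [n]-th power, leaving
    [(a)_(m n) / (c)_(m n)] and the expansion with weight
    [(1 - lam x) ^ - a]. *)
Lemma hyp_weighted (a c lam kap : Complex.C) (m : nat)
    (k k' : Complex.C -> Complex.C) (u : nat -> Complex.C) :
  (forall n : nat, c <> - INR n) -> (1 <= m)%nat -> is_taylor k u ->
  is_taylor k' (fun n => u n * (poch a (m * n) / poch c (m * n))) ->
  germ_eq (hyp a c (weighted lam kap m c k)) (weighted lam kap m a k').
Proof.
intros hc Hm Hk Hk'.
apply is_taylor_eq with (fun N => weighted_coefs lam kap m c u N * (poch a N / poch c N)).
- now apply hyp_taylor; [|apply weighted_taylor].
- replace (fun N => weighted_coefs lam kap m c u N * (poch a N / poch c N))
    with (weighted_coefs lam kap m a (fun n => u n * (poch a (m * n) / poch c (m * n))));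
    [now apply weighted_taylor|].
  apply functional_extensionality; intros N; unfold weighted_coefs.
  rewrite <- Csum_mult_r; apply Csum_ext; intros n _; unfold weighted_term.
  destruct (le_lt_dec (m * n) N) as [h|h]; [|ring].
  pose proof (binc_ratio a c (m * n) (N - m * n) hc) as E.
  replace (m * n + (N - m * n))%nat with N in E by lia.
  transitivity (u n * kap ^ n * lam ^ (N - m * n) *
    (poch a (m * n) / poch c (m * n) * binc (a + INR (m * n)) (N - m * n))); [ring|].
  rewrite <- E; ring.
Qed.

Lemma hyp_weighted_linear (a c lam kap : Complex.C) (k : Complex.C -> Complex.C) :
  (forall n : nat, c <> - INR n) -> analytic0 k ->
  germ_eq (hyp a c (weighted lam kap 1 c k)) (weighted lam kap 1 a (hyp a c k)).
Proof.
intros hc [u Hu]; apply hyp_weighted with u; auto.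
replace (fun n => u n * (poch a (1 * n) / poch c (1 * n)))
  with (fun n => u n * (poch a n / poch c n)); [now apply hyp_taylor|].
apply functional_extensionality; intros n; now rewrite Nat.mul_1_l.
Qed.

(** Duplication: [(a)_(2 n)] is [4 ^ n] times the product of [(a / 2)_n] and
    [((a + 1) / 2)_n]. *)
Lemma hyp_weighted_quadratic (a c lam kap : Complex.C) (k k' : Complex.C -> Complex.C)
    (u : nat -> Complex.C) :
  (forall n : nat, c <> - INR n) -> is_taylor k u ->
  is_taylor k' (fun n => u n * (poch (a / 2) n * poch ((a + 1) / 2) n /
    (poch (c / 2) n * poch ((c + 1) / 2) n))) ->
  germ_eq (hyp a c (weighted lam kap 2 c k)) (weighted lam kap 2 a k').
Proof.
intros hc Hu Hk'; apply hyp_weighted with u; auto.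
eapply eq_ind; [exact Hk'|].
apply functional_extensionality; intros n; f_equal.
destruct (half_not_neg_nat c hc) as [h1 h2].
pose proof (poch_neq0 _ h1 n); pose proof (poch_neq0 _ h2 n).
rewrite !poch_double; field; repeat split; auto.
apply Cpow_nz; intros E; apply RtoC_inj in E; lra.
Qed.

(** * The Pfaff substitution *)

(** The involution [z / (z - 1)], written so that the results on weighted
    substitutions apply. *)
Definition sigma : Complex.C -> Complex.C := subst_arg 1 (- (1)) 1.

Definition pfaff : Complex.C -> (Complex.C -> Complex.C) -> Complex.C -> Complex.C :=
  weighted 1 (- (1)) 1.

Lemma one_minus_sigma (z : Complex.C) : 1 - 1 * z <> 0 -> 1 - sigma z = / (1 - 1 * z).
Proof.
intros H; unfold sigma, subst_arg; rewrite Cpow_1_r.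
replace (1 - 1 * z) with (1 - z) in * by ring; field; exact H.
Qed.

Lemma sigma_involutive (z : Complex.C) : 1 - 1 * z <> 0 -> sigma (sigma z) = z.
Proof.
intros H; unfold sigma at 1; unfold subst_arg; rewrite Cpow_1_r, Cmult_1_l.
rewrite one_minus_sigma by exact H.
unfold sigma, subst_arg; rewrite Cpow_1_r.
replace (1 - 1 * z) with (1 - z) in * by ring; field; auto.
Qed.

Lemma Cpower_one_minus_sigma (z s : Complex.C) :
  (Cmod (1 * z)%C < / 2)%R -> Cpower (1 - sigma z) s = Cpower (1 - 1 * z) (- s).
Proof.
intros H; rewrite one_minus_sigma by (apply Re_pos_neq0, near1_Re, H).
apply Cpower_inv, near1_bounds, H.
Qed.

Lemma weighted_analytic (lam kap : Complex.C) (m : nat) (p : Complex.C)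
    (k : Complex.C -> Complex.C) :
  (1 <= m)%nat -> analytic0 k -> analytic0 (weighted lam kap m p k).
Proof. intros Hm [u Hu]; eexists; apply weighted_taylor; eassumption. Qed.

Lemma hyp_analytic (a c : Complex.C) (f : Complex.C -> Complex.C) :
  (forall n : nat, c <> - INR n) -> analytic0 f -> analytic0 (hyp a c f).
Proof. intros hc [u Hu]; eexists; apply hyp_taylor; eassumption. Qed.

(** Two Pfaff substitutions cancel except for the weight, which makes analyticity
    of the product a consequence of [weighted_taylor]. *)
Lemma mult_power_analytic (s : Complex.C) (k : Complex.C -> Complex.C) :
  analytic0 k -> analytic0 (fun w => Cpower (1 - w) s * k w).
Proof.
intros Hk.
destruct (weighted_analytic 1 (- (1)) 1 (- s) _ (le_n 1)
  (weighted_analytic 1 (- (1)) 1 0 k (le_n 1) Hk)) as [v Hv].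
exists v; apply is_taylor_germ with (2 := Hv).
generalize (near0_unit 1); apply near0_imp; intros w Hw.
unfold weighted; change (subst_arg 1 (- (1)) 1) with sigma.
rewrite sigma_involutive by exact Hw.
replace (- (0)) with (RtoC 0) by ring; rewrite Cpower_0.
replace (1 - 1 * w) with (1 - w) by ring; replace (- - s) with s by ring; ring.
Qed.

(** Each of the two operators is carried through the substitution by
    [hyp_weighted_linear], which requires the weight exponent to be its lower
    parameter; between the two steps the exponent is adjusted from [A'] to [C],
    and the excess is a power of [1 - sigma z = / (1 - z)]. *)
Lemma hyp_hyp_pfaff (A C A' C' : Complex.C) (g : Complex.C -> Complex.C) :
  (forall n : nat, C <> - INR n) -> (forall n : nat, C' <> - INR n) -> analytic0 g ->
  germ_eq (hyp A C (hyp A' C' (pfaff C' g)))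
    (pfaff A (hyp A C (fun w => Cpower (1 - w) (- (C - A')) * hyp A' C' g w))).
Proof.
intros hC hC' Hg; set (q w := Cpower (1 - w) (- (C - A')) * hyp A' C' g w).
assert (Hq : analytic0 q) by (apply mult_power_analytic, hyp_analytic; auto).
assert (E : germ_eq (hyp A' C' (pfaff C' g)) (pfaff C q)).
{ apply germ_trans with (1 := hyp_weighted_linear A' C' 1 (- (1)) g hC' Hg).
  generalize (near0_scal_small 1 (/ 2) ltac:(lra)); apply near0_imp; intros z Hz.
  unfold pfaff, weighted, q; change (subst_arg 1 (- (1)) 1) with sigma.
  rewrite Cpower_one_minus_sigma by exact Hz.
  rewrite Cmult_assoc, <- Cpower_add; do 2 f_equal; ring. }
assert (Hl : analytic0 (hyp A' C' (pfaff C' g)))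
  by (apply hyp_analytic, weighted_analytic; auto).
rewrite (hyp_germ A C _ _ Hl E).
now apply hyp_weighted_linear.
Qed.

(** * Quadratic transformations *)

Lemma hyp_at_mult_hyp_at (A C A' C' s : Complex.C) (y f g : Complex.C -> Complex.C) :
  (forall n : nat, C' <> - INR n) -> small_nonconstant y -> factors_by y f g ->
  hyp_at A C y (mult (fun x => Cpower (1 - y x) s) (hyp_at A' C' y f))
  = fun x => hyp A C (fun w => Cpower (1 - w) s * hyp A' C' g w) (y x).
Proof.
intros hC' Hy Hfg; rewrite (hyp_at_factors A' C' y f g Hy Hfg).
apply hyp_at_factors; [assumption|]; split.
- apply mult_power_analytic, hyp_analytic; [assumption | apply Hfg].
- apply near0_all; intros x; reflexivity.
Qed.

(** The quadratic substitution turns [hyp a c] into the product of the two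
    operators in the variable [z = subst_arg lam kap 2 x], and [hyp_hyp_pfaff]
    passes from [z] to [y = sigma z]. *)
Lemma quadratic_pfaff (a c A C A' C' lam kap : Complex.C)
    (y W0 W1 f g : Complex.C -> Complex.C) :
  (forall n : nat, c <> - INR n) ->
  (forall n : nat, C <> - INR n) -> (forall n : nat, C' <> - INR n) ->
  (forall n, poch A n * poch A' n = poch (a / 2) n * poch ((a + 1) / 2) n) ->
  (forall n, poch C n * poch C' n = poch (c / 2) n * poch ((c + 1) / 2) n) ->
  kap <> 0 ->
  near0 (fun x => y x = sigma (subst_arg lam kap 2 x)) ->
  near0 (fun x => W0 x =
    Cpower (1 - lam * x) (- c) * Cpower (1 - 1 * subst_arg lam kap 2 x) (- C')) ->
  near0 (fun x => W1 x *
    (Cpower (1 - lam * x) (- a) * Cpower (1 - 1 * subst_arg lam kap 2 x) (- A)) = 1) ->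
  factors_by y f g ->
  germ_eq (mult W1 (hyp a c (mult W0 f)))
    (hyp_at A C y (mult (fun x => Cpower (1 - y x) (- (C - A'))) (hyp_at A' C' y f))).
Proof.
intros hc hC hC' HA HC Hkap Hy HW0 HW1 Hfg.
assert (H2 : (1 <= 2)%nat) by lia.
assert (Hin : forall P : Complex.C -> Prop, near0 P -> near0 (fun x => P (subst_arg lam kap 2 x))).
{ intros P (r & Hr & HP); generalize (subst_arg_small lam kap 2 r H2 Hr).
  apply near0_imp; auto. }
assert (Hsn : small_nonconstant y).
{ split.
  - intros eps Heps.
    generalize (near0_and _ _ Hy (Hin _ (subst_arg_small 1 (- (1)) 1 eps (le_n 1) Heps))).
    apply near0_imp; intros x [-> H]; exact H.
  - generalize (near0_and _ _ Hy (near0_and _ _ (near0_unit lam) (Hin _ (near0_unit 1)))).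
    apply near0_imp; intros x (-> & Hn & Hn1) Hx.
    apply subst_arg_neq0; [|exact Hn1 | now apply subst_arg_neq0].
    intros E; apply C1_nz; replace (RtoC 1) with (- - (1)) by ring; rewrite E; ring. }
rewrite (hyp_at_mult_hyp_at A C A' C' _ y f g hC' Hsn Hfg).
destruct Hfg as [Hg Hf].
set (k := pfaff C' g).
assert (Hk : analytic0 k) by (apply weighted_analytic; auto).
assert (E0 : germ_eq (weighted lam kap 2 c k) (mult W0 f)).
{ generalize (near0_and _ _ Hf (near0_and _ _ Hy HW0)); apply near0_imp; intros x (Ef & Ey & Ew).
  unfold mult; rewrite Ef, Ey, Ew; unfold weighted at 1, k, pfaff, weighted at 1.
  fold sigma; ring. }
rewrite <- (hyp_germ a c _ _ (weighted_analytic lam kap 2 c k H2 Hk) E0).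
destruct Hk as [u Hu].
assert (E1 : germ_eq (hyp a c (weighted lam kap 2 c k))
    (weighted lam kap 2 a (hyp A C (hyp A' C' k)))).
{ apply hyp_weighted_quadratic with u; auto.
  eapply eq_ind; [exact (hyp_taylor A C _ _ hC (hyp_taylor A' C' k u hC' Hu))|].
  apply functional_extensionality; intros n; rewrite <- HA, <- HC.
  field; split; now apply poch_neq0. }
generalize (near0_and _ _ E1 (near0_and _ _ (Hin _ (hyp_hyp_pfaff A C A' C' g hC hC' Hg))
  (near0_and _ _ HW1 Hy))).
apply near0_imp; intros x (F1 & F2 & F3 & F4).
unfold mult at 1; rewrite F1; unfold weighted; fold k in F2; rewrite F2, F4.
unfold pfaff, weighted; fold sigma.
match goal with |- _ = ?r => transitivity (W1 x *
    (Cpower (1 - lam * x) (- a) * Cpower (1 - 1 * subst_arg lam kap 2 x) (- A)) * r) end.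
- ring.
- rewrite F3; ring.
Qed.

(** [1 - x = (1 - x / 2) ^ 2 * (1 - z)] for [z = x ^ 2 / (2 - x) ^ 2]; the three
    factors are close enough to 1 for the branches to multiply. *)
Lemma Cpower_quadratic (x s : Complex.C) :
  (Cmod x < / 4)%R -> (Cmod (1 * subst_arg (/ 2) (/ 4) 2 x)%C < / 2)%R ->
  Cpower (1 - x) s
  = Cpower (1 - / 2 * x) (s + s) * Cpower (1 - 1 * subst_arg (/ 2) (/ 4) 2 x) s.
Proof.
intros Hx Hz.
assert (Hv : (Cmod (/ 2 * x)%C < / 2)%R).
{ rewrite Cmod_mult, Cmod_inv, Cmod_R, Rabs_pos_eq by (try lra; intros E; apply RtoC_inj in E; lra).
  lra. }
assert (He : (Cmod (x * (1 - / 4 * x))%C < / 2)%R).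
{ rewrite Cmod_mult; pose proof (Cmod_triangle 1 (- (/ 4 * x))) as H.
  rewrite Cmod_1, Cmod_opp, Cmod_mult, Cmod_inv, Cmod_R, Rabs_pos_eq in H
    by (try lra; intros E; apply RtoC_inj in E; lra).
  pose proof (Cmod_ge_0 x); unfold Cminus; nra. }
pose proof (Re_pos_neq0 _ (near1_Re _ Hv)) as Hn.
rewrite Cpower_add, <- Cpower_mult by (apply near1_bounds; exact Hv).
assert (E : (1 - / 2 * x) * (1 - / 2 * x) = 1 - x * (1 - / 4 * x)) by field.
rewrite E, <- Cpower_mult by (apply near1_bounds; assumption).
f_equal; rewrite <- E; unfold subst_arg; field.
intros H; apply Hn; replace (1 - / 2 * x) with ((2 - x) / 2) by field; rewrite H; field.
Qed.

Theorem mainTheorem8 (a c : Complex.C) (hc : forall n : nat, c <> - INR n) :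
  (let y : Complex.C -> Complex.C := fun x => x ^ 2 / (4 * (x - 1)) in
   forall f g : Complex.C -> Complex.C, factors_by y f g ->
   germ_eq
     (mult (fun x => Cpower (1 - x) (a / 2))
        (hyp a c
           (mult (fun x => Cpower (1 - x) (- (c / 2))) f)))
     (hyp_at (a / 2) ((c + 1) / 2) y
        (mult (fun x => Cpower (1 - y x) (- ((c - a) / 2)))
           (hyp_at ((a + 1) / 2) (c / 2) y f))))
  /\
  (let y : Complex.C -> Complex.C := fun x => x ^ 2 / (2 - x) ^ 2 in
   forall f g : Complex.C -> Complex.C, factors_by y f g ->
   germ_eq
     (mult (fun x => Cpower (1 - x / 2) a)
        (hyp a c
           (mult (fun x => Cpower (1 - x / 2) (- c)) f)))
     (hyp_at (a / 2) ((c + 1) / 2) y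
        (hyp_at ((a + 1) / 2) (c / 2) y f)))
  /\
  (let y : Complex.C -> Complex.C := fun x => x ^ 2 / (x ^ 2 - 1) in
   forall f g : Complex.C -> Complex.C, factors_by y f g ->
   germ_eq
     (mult (fun x => Cpower (1 - x ^ 2) ((a + 1) / 2))
        (hyp a c
           (mult (fun x => Cpower (1 - x ^ 2) (- ((c + 1) / 2))) f)))
     (hyp_at ((a + 1) / 2) (c / 2) y
        (mult (fun x => Cpower (1 - y x) (- ((c - a) / 2)))
           (hyp_at (a / 2) ((c + 1) / 2) y f)))).
Proof.
destruct (half_not_neg_nat c hc) as [h1 h2].
assert (N2 : RtoC 2 <> 0) by (intros E; apply RtoC_inj in E; lra).
assert (N4 : RtoC 4 <> 0) by (intros E; apply RtoC_inj in E; lra).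
assert (H4 : / 4 <> 0).
{ intros E; apply C1_nz; rewrite <- (Cinv_r 4), E by exact N4; ring. }
assert (Hz : near0 (fun x => (Cmod x < / 4)%R /\
    (Cmod (1 * subst_arg (/ 2) (/ 4) 2 x)%C < / 2)%R)).
{ apply near0_and; [apply near0_small; lra|].
  generalize (subst_arg_small (/ 2) (/ 4) 2 (/ 2) ltac:(lia) ltac:(lra)).
  apply near0_imp; intros x; now rewrite Cmult_1_l. }
assert (Hu : near0 (fun x => 1 - x <> 0 /\ 2 - x <> 0)).
{ generalize (near0_and _ _ (near0_unit 1) (near0_unit (/ 2))).
  apply near0_imp; intros x [U1 U2]; split; intros E.
  - apply U1; rewrite <- E; ring.
  - apply U2; replace (1 - / 2 * x) with ((2 - x) / 2) by field; rewrite E; field. }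
split; [|split]; intros y f g Hfg.
- replace (- ((c - a) / 2)) with (- ((c + 1) / 2 - (a + 1) / 2)) by field.
  apply quadratic_pfaff with (/ 2) (/ 4) g; auto.
  + intros n; ring.
  + generalize Hu; apply near0_imp; intros x [U1 U2].
    unfold y, sigma, subst_arg; field; repeat split; auto.
    * intros E; apply U1.
      replace (1 - x) with ((4 * (2 - x) ^ 2 - x ^ 2 * 4) / (4 * 4)) by (field; exact N4).
      rewrite E; field; exact N4.
    * intros E; apply U1; replace (1 - x) with (- (x - 1)) by ring; rewrite E; ring.
  + generalize Hz; apply near0_imp; intros x [Z1 Z2].
    rewrite (Cpower_quadratic x _ Z1 Z2); f_equal; f_equal; field.
  + generalize Hz; apply near0_imp; intros x [Z1 Z2].
    transitivity (Cpower (1 - x) (a / 2) * Cpower (1 - x) (- (a / 2))); [|apply Cpower_opp].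
    f_equal; rewrite (Cpower_quadratic x (- (a / 2)) Z1 Z2); f_equal; f_equal; field.
- assert (Ey : germ_eq (subst_arg (/ 2) (/ 4) 2) y).
  { generalize Hu; apply near0_imp; intros x [U1 U2].
    unfold y, subst_arg; field; auto. }
  assert (Hy : small_nonconstant y).
  { apply subst_arg_small_nonconstant with (/ 2) (/ 4) 2%nat; auto. }
  rewrite (hyp_at_factors _ _ y f g Hy Hfg).
  destruct Hfg as [Hg Hf]; destruct Hg as [u Hg].
  set (g1 := hyp ((a + 1) / 2) (c / 2) g).
  pose proof (hyp_taylor ((a + 1) / 2) (c / 2) g u h1 Hg) as Hg1; fold g1 in Hg1.
  rewrite (hyp_at_factors _ _ y (fun x => g1 (y x)) g1 Hy)
    by (split; [eexists; exact Hg1 | apply near0_all; reflexivity]).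
  assert (E0 : germ_eq (weighted (/ 2) (/ 4) 2 c g)
      (mult (fun x => Cpower (1 - x / 2) (- c)) f)).
  { generalize (near0_and _ _ Hf Ey); apply near0_imp; intros x [F1 F2].
    unfold mult, weighted; rewrite F1, F2; do 3 f_equal; field. }
  rewrite <- (hyp_germ a c _ _ (weighted_analytic (/ 2) (/ 4) 2 c g ltac:(lia)
    (ex_intro _ u Hg)) E0).
  assert (E1 : germ_eq (hyp a c (weighted (/ 2) (/ 4) 2 c g))
      (weighted (/ 2) (/ 4) 2 a (hyp (a / 2) ((c + 1) / 2) g1))).
  { apply hyp_weighted_quadratic with u; auto.
    eapply eq_ind; [exact (hyp_taylor (a / 2) ((c + 1) / 2) g1 _ h2 Hg1)|].
    apply functional_extensionality; intros n; field; split; now apply poch_neq0. }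
  generalize (near0_and _ _ E1 Ey); apply near0_imp; intros x [F1 F2].
  unfold mult; rewrite F1; unfold weighted; rewrite F2.
  replace (1 - x / 2) with (1 - / 2 * x) by field.
  rewrite Cmult_assoc, Cpower_opp; ring.
- replace (- ((c - a) / 2)) with (- (c / 2 - a / 2)) by field.
  assert (Es : forall x, subst_arg 0 1 2 x = x ^ 2).
  { intros x; unfold subst_arg; field. }
  assert (E1 : forall x s, Cpower (1 - 0 * x) s = 1).
  { intros x s; replace (1 - 0 * x) with (RtoC 1) by ring; apply Cpower_1. }
  apply quadratic_pfaff with (RtoC 0) (RtoC 1) g; auto using C1_nz.
  + intros n; ring.
  + generalize (near0_and _ _ (near0_unit 1) (near0_unit (- (1)))).
    apply near0_imp; intros x [U1 U2]; rewrite Es; unfold y, sigma, subst_arg.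
    assert (U : x ^ 2 - 1 <> 0).
    { replace (x ^ 2 - 1) with (- ((1 - 1 * x) * (1 - - (1) * x))) by ring.
      intros E; apply (Cmult_neq_0 _ _ U1 U2).
      match type of E with - ?w = _ => replace w with (- - w) by ring end.
      rewrite E; ring. }
    field; split; [|exact U].
    intros E; apply U; replace (x ^ 2 - 1) with (- (1 - x ^ 2)) by ring; rewrite E; ring.
  + apply near0_all; intros x; rewrite Es, E1, !Cmult_1_l; reflexivity.
  + apply near0_all; intros x; rewrite Es, E1, !Cmult_1_l; apply Cpower_opp.
Qed.
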